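(* Let $M\in\mathcal{M}_{3,2}^{p\times q}$ have all entries positive, and let $(A^{(1)},\ldots,A^{(p)},B^{(1)},\ldots,B^{(q)})$ with $A^{(i)},B^{(j)}\in\mathcal{S}^2_+$ be a size-$2$ psd factorization of $M$. Then the following are equivalent: (a) the factorization is $1$-infinitesimally rigid; (b) the factorization is $2$-infinitesimally rigid; (c) the factorization is locally rigid; (d) the factorization is globally rigid.
   Context: $\mathcal{S}^2$ (resp. $\mathcal{S}^2_+$) is the set of real symmetric (resp. symmetric positive semidefinite, psd) $2\times2$ matrices; $\langle X,Y\rangle=\operatorname{trace}(XY)$. A size-$k$ psd factorization of a nonnegative $p\times q$ matrix $M$ is a tuple $A^{(1)},\dots,A^{(p)},B^{(1)},\dots,B^{(q)}$ of $k\times k$ psd matrices with $M_{ij}=\langle A^{(i)},B^{(j)}\rangle$; the psd rank of $M$ is the smallest such $k$. $\mathcal{M}_{3,2}^{p\times q}$ is the set of nonnegative $p\times q$ matrices of rank $3$ and psd rank $2$. For $s\in\{1,2\}$, an $s$-infinitesimal motion of a size-$2$ psd factorization is a tuple $(\dot A^{(1)},\dots,\dot A^{(p)},\dot B^{(1)},\dots,\dot B^{(q)})$ of matrices in $\mathcal{S}^2$ such that (1) $\langle\dot A^{(i)},B^{(j)}\rangle+\langle A^{(i)},\dot B^{(j)}\rangle=0$ for all $i,j$; and (2) there is $\varepsilon>0$ such that for all $t\in[0,\varepsilon)$ and all nonempty $I\subseteq\{1,2\}$, $T^s([A^{(i)}+t\dot A^{(i)}]_I)\ge0$ for all $i$ and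 $T^s([B^{(j)}+t\dot B^{(j)}]_I)\ge0$ for all $j$. Here $[X]_I$ is the principal minor of $X$ with index set $I$, and $T^s(f)$ is the Taylor polynomial of order $s$ at $t=0$ of the polynomial $f(t)$. Put $\operatorname{vec}(X)=(X_{11},X_{22},\sqrt2X_{12})$ (row vector). If $M\in\mathcal{M}_{3,2}^{p\times q}$, every $s$-infinitesimal motion is given by a unique $D\in\mathbb{R}^{3\times3}$ via $\operatorname{vec}(\dot A^{(i)})=\operatorname{vec}(A^{(i)})D$ and $\operatorname{vec}(\dot B^{(j)})^T=-D\operatorname{vec}(B^{(j)})^T$. The motion is $s$-trivial if the same $D$ gives, by these formulas, an $s$-infinitesimal motion of every size-$2$ psd factorization of every matrix in $\mathcal{M}_{3,2}^{p\times q}$. A size-$2$ psd factorization of $M$ is $s$-infinitesimally rigid if all its $s$-infinitesimal motions are $s$-trivial. $\mathrm{GL}(2)$ acts on size-$2$ psd factorizations of $M$ by $(A^{(i)},B^{(j)})\mapsto(S^TA^{(i)}S,S^{-1}B^{(j)}S^{-T})$. A size-$2$ psd factorization of $M$ is locally rigid if it has a neighborhood, in the space of all size-$2$ psd factorizations of $M$ (Euclidean topology), in which every psd factorization of $M$ lies in its $\mathrm{GL}(2)$-orbit; it is globally rigid if every size-$2$ psd factorization of $M$ lies in its $\mathrm{GL}(2)$-orbit. *)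

(* Defs.v *)
From HB Require Import structures.
From mathcomp Require Import all_boot all_order all_algebra.
From mathcomp Require Import all_classical all_reals all_analysis.

Set Implicit Arguments.
Unset Strict Implicit.
Unset Printing Implicit Defensive.

Import Order.TTheory GRing.Theory Num.Theory.
Import numFieldNormedType.Exports.

Local Open Scope ring_scope.

Section Psd.
Variable R : realType.

Definition psdmx k (X : 'M[R]_k) : Prop :=
  X^T = X /\ forall v : 'rV[R]_k, 0 <= (v *m X *m v^T) 0 0.

Definition mxdot k (X Y : 'M[R]_k) : R := \tr (X *m Y).

Definition psd_factorization k p q (M : 'M[R]_(p, q))
    (A : 'I_p -> 'M[R]_k) (B : 'I_q -> 'M[R]_k) : Prop :=
  [/\ forall i, psdmx (A i), forall j, psdmx (B j)
    & forall i j, M i j = mxdot (A i) (B j)].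

Definition has_psd_factorization k p q (M : 'M[R]_(p, q)) : Prop :=
  exists (A : 'I_p -> 'M[R]_k) (B : 'I_q -> 'M[R]_k), psd_factorization M A B.

Definition psd_rank_is p q (M : 'M[R]_(p, q)) (k : nat) : Prop :=
  has_psd_factorization k M /\
  forall k', has_psd_factorization k' M -> (k <= k')%N.

Definition rank3_psd_rank2 p q (M : 'M[R]_(p, q)) : Prop :=
  [/\ forall i j, 0 <= M i j, \rank M = 3 & psd_rank_is M 2].

Definition principal_minor (S : comNzRingType) n (I : {set 'I_n})
    (X : 'M[S]_n) : S :=
  \det (mxsub (@enum_val _ (mem I)) (@enum_val _ (mem I)) X).

(* [f^`N(k)] is the k-th derivative of [f] divided by k!. *)
Definition taylor (s : nat) (f : {poly R}) : {poly R} :=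
  \sum_(k < s.+1) (f^`N(k)).[0] *: 'X^k.

(* The matrix X + t dX, as a matrix of polynomials in the indeterminate t. *)
Definition line_mx n (X dX : 'M[R]_n) : 'M[{poly R}]_n :=
  map_mx polyC X + 'X *: map_mx polyC dX.

Definition inf_motion (s : nat) p q
    (A : 'I_p -> 'M[R]_2) (B : 'I_q -> 'M[R]_2)
    (dA : 'I_p -> 'M[R]_2) (dB : 'I_q -> 'M[R]_2) : Prop :=
  [/\ forall i, (dA i)^T = dA i, forall j, (dB j)^T = dB j,
      forall i j, mxdot (dA i) (B j) + mxdot (A i) (dB j) = 0
    & exists2 e : R, 0 < e & forall t : R, 0 <= t < e ->
        forall I : {set 'I_2}, I != finset.set0 ->
          (forall i, 0 <= (taylor s (principal_minor I
                              (line_mx (A i) (dA i)))).[t]) /\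
          (forall j, 0 <= (taylor s (principal_minor I
                              (line_mx (B j) (dB j)))).[t])].

Definition vec (X : 'M[R]_2) : 'rV[R]_3 :=
  \row_(k < 3) [:: X 0 0; X 1 1; Num.sqrt 2 * X 0 1]`_k.

Definition given_by (D : 'M[R]_3) p q
    (A : 'I_p -> 'M[R]_2) (B : 'I_q -> 'M[R]_2)
    (dA : 'I_p -> 'M[R]_2) (dB : 'I_q -> 'M[R]_2) : Prop :=
  (forall i, vec (dA i) = vec (A i) *m D) /\
  (forall j, (vec (dB j))^T = - (D *m (vec (B j))^T)).

(* [vec] is a bijection between symmetric matrices and row vectors, so [D],
   [A'] and [B'] determine the symmetric tuples [dA'] and [dB']; hence the
   inner [exists] only names the tuple given by [D].  Likewise, the outer
   [exists] ranges over at most one [D] when [A] and [B] factor a matrix of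
   rank 3. *)
Definition trivial_motion (s : nat) p q
    (A : 'I_p -> 'M[R]_2) (B : 'I_q -> 'M[R]_2)
    (dA : 'I_p -> 'M[R]_2) (dB : 'I_q -> 'M[R]_2) : Prop :=
  exists2 D : 'M[R]_3, given_by D A B dA dB &
    forall (M' : 'M[R]_(p, q)) (A' : 'I_p -> 'M[R]_2) (B' : 'I_q -> 'M[R]_2),
      rank3_psd_rank2 M' -> psd_factorization M' A' B' ->
      exists (dA' : 'I_p -> 'M[R]_2) (dB' : 'I_q -> 'M[R]_2),
        given_by D A' B' dA' dB' /\ inf_motion s A' B' dA' dB'.

Definition inf_rigid (s : nat) p q
    (A : 'I_p -> 'M[R]_2) (B : 'I_q -> 'M[R]_2) : Prop :=
  forall dA dB, inf_motion s A B dA dB -> trivial_motion s A B dA dB.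

Definition GL2_orbit p q (A : 'I_p -> 'M[R]_2) (B : 'I_q -> 'M[R]_2)
    (A' : 'I_p -> 'M[R]_2) (B' : 'I_q -> 'M[R]_2) : Prop :=
  exists2 S : 'M[R]_2, S \in unitmx &
    (forall i, A' i = S^T *m A i *m S) /\
    (forall j, B' j = invmx S *m B j *m (invmx S)^T).

(* The product topology on (M_2)^p x (M_2)^q is the Euclidean one. *)
Definition mx2_tuples p q : topologicalType :=
  (prod_topology (fun _ : 'I_p => 'M[R]_2) *
   prod_topology (fun _ : 'I_q => 'M[R]_2))%type.

Definition locally_rigid p q (M : 'M[R]_(p, q))
    (A : 'I_p -> 'M[R]_2) (B : 'I_q -> 'M[R]_2) : Prop :=
  \forall F \near ((A, B) : mx2_tuples p q),
    psd_factorization M F.1 F.2 -> GL2_orbit A B F.1 F.2.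

Definition globally_rigid p q (M : 'M[R]_(p, q))
    (A : 'I_p -> 'M[R]_2) (B : 'I_q -> 'M[R]_2) : Prop :=
  forall A' B', psd_factorization M A' B' -> GL2_orbit A B A' B'.

End Psd.

(* Main.v *)
Require Import Defs.
From mathcomp Require Import all_boot all_order all_algebra.
From mathcomp Require Import all_classical all_reals all_analysis.
From mathcomp Require Import ring lra zify.
Import Order.TTheory GRing.Theory Num.Theory.
Import numFieldNormedType.Exports.
Local Open Scope classical_set_scope.
Local Open Scope ring_scope.
Set Implicit Arguments.
Unset Strict Implicit.
Unset Printing Implicit Defensive.

(** The symmetric matrices of size two form, through [vec], a space with a
    Lorentz form (twice the determinant), and the psd matrices form one half of
    its solid cone. Since the factors span this three-dimensional space, the
    other factorizations of [M] are obtained from [(A, B)] by an invertible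
    linear map applied to the [A i] and its inverse transpose applied to the [B
    j]; the [GL(2)]-orbit corresponds to the maps preserving the cone. All four
    notions of rigidity are shown to be equivalent to one condition on the rank-
    one factors.

    The light rays form a conic, parametrized by the projective line, and a
    quadratic form restricted to the conic is a binary quartic. A generator [D]
    moves a light ray [x] to first order inwards or outwards according to the
    sign of the form [D *m J] at [x]. A rank-one [A i] has to move inwards. A
    rank-one [B j] supports the cone along the light ray of its adjugate, and
    that ray has to move outwards. So what matters is whether a nonzero quartic
    can be nonnegative at the rays of the [A i] and nonpositive at the rays of
    the adjugates of the [B j]. The factorization is called quartic rigid if it
    cannot.

    If it is quartic rigid, a first order motion has zero quartic, hence is
    trivial; for a second order motion, the second order term is a further
    quartic subject to the same signs, hence vanishes too
    ([quartic_rigid_inf_rigid]). For another factorization, the Lorentz form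
    pulled back by the linear map satisfies the same signs, because the cone
    pulled back contains the [A i] and lies in the half-spaces of the [B j]; so
    it is a multiple of the Lorentz form and the map is a congruence
    ([quartic_rigid_globally_rigid]).

    If it is not quartic rigid, positivity of [M] says that no ray of an [A i]
    is the ray of the adjugate of a [B j]. A quartic with weak signs can then be
    perturbed to one with strict signs ([strict_signs]), and its generator moves
    all factors strictly into the cone. This gives an infinitesimal motion of
    either order that is not trivial ([separating_not_inf_rigid]), and actual
    factorizations of [M] arbitrarily near the given one and outside its orbit
    ([separating_not_locally_rigid]). *)

(** * Symmetric matrices of size two as Lorentz space *)

Section Coordinates.
Variable R : realType.
Implicit Types (x y z u v : 'rV[R]_3) (X Y : 'M[R]_2) (K D G : 'M[R]_3).

Local Notation s2 := (Num.sqrt (2 : R)).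

Lemma sqrt2_sq : s2 * s2 = 2.
Proof. by rewrite -expr2 sqr_sqrtr. Qed.

Lemma sqrt2_neq0 : s2 != 0.
Proof. by rewrite sqrtr_eq0 -ltNge. Qed.

Lemma sum3 (F : 'I_3 -> R) : \sum_i F i = F 0 + F 1 + F 2.
Proof.
rewrite !big_ord_recl big_ord0 addr0 addrA.
by congr (_ + F _ + F _); apply: val_inj.
Qed.

Lemma ord3P (P : 'I_3 -> Prop) : P 0 -> P 1 -> P 2 -> forall i, P i.
Proof.
move=> P0 P1 P2 [[|[|[|//]]] lt_i].
- by rewrite (_ : Ordinal lt_i = 0) //; apply: val_inj.
- by rewrite (_ : Ordinal lt_i = 1) //; apply: val_inj.
- by rewrite (_ : Ordinal lt_i = 2) //; apply: val_inj.
Qed.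

Lemma ord2P (P : 'I_2 -> Prop) : P 0 -> P 1 -> forall i, P i.
Proof.
move=> P0 P1 [[|[|//]] lt_i].
- by rewrite (_ : Ordinal lt_i = 0) //; apply: val_inj.
- by rewrite (_ : Ordinal lt_i = 1) //; apply: val_inj.
Qed.

Lemma row3P x y : x 0 0 = y 0 0 -> x 0 1 = y 0 1 -> x 0 2 = y 0 2 -> x = y.
Proof.
by move=> e0 e1 e2; apply/rowP; apply: ord3P.
Qed.

Definition row3 (a b c : R) : 'rV[R]_3 := \row_(k < 3) [:: a; b; c]`_k.

Lemma row3E a b c :
  (row3 a b c 0 0 = a) * (row3 a b c 0 1 = b) * (row3 a b c 0 2 = c).
Proof. by rewrite !mxE. Qed.

Lemma vecE X : (vec X 0 0 = X 0 0) * (vec X 0 1 = X 1 1) *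
  (vec X 0 2 = s2 * X 0 1).
Proof. by rewrite !mxE. Qed.

Lemma mx2P X Y : X 0 0 = Y 0 0 -> X 0 1 = Y 0 1 -> X 1 0 = Y 1 0 ->
  X 1 1 = Y 1 1 -> X = Y.
Proof.
by move=> *; apply/matrixP; apply: ord2P => j; elim/ord2P: j.
Qed.

Definition unvec x : 'M[R]_2 :=
  \matrix_(i, j) (if i == j then x 0 (if i == 0 then 0 else 1) else x 0 2 / s2).

Lemma unvecE x : (unvec x 0 0 = x 0 0) * (unvec x 0 1 = x 0 2 / s2) *
  (unvec x 1 0 = x 0 2 / s2) * (unvec x 1 1 = x 0 1).
Proof. by rewrite !mxE. Qed.

Lemma unvec_sym x : (unvec x)^T = unvec x.
Proof. by apply: mx2P; rewrite !mxE. Qed.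

Lemma unvecK x : vec (unvec x) = x.
Proof.
apply: row3P; rewrite ?vecE ?unvecE // mulrC divfK //; exact: sqrt2_neq0.
Qed.

Lemma sym01 X : X^T = X -> X 1 0 = X 0 1.
Proof. by move=> sX; rewrite -{1}sX mxE. Qed.

Lemma vecK X : X^T = X -> unvec (vec X) = X.
Proof.
move=> sX; have := sqrt2_neq0 => nz.
by apply: mx2P; rewrite ?unvecE ?vecE ?(sym01 sX) // mulrC mulKf.
Qed.

Lemma dotE x y : (x *m y^T) 0 0 = x 0 0 * y 0 0 + x 0 1 * y 0 1 + x 0 2 * y 0 2.
Proof. by rewrite mxE sum3 !mxE. Qed.

Lemma sum2 (F : 'I_2 -> R) : \sum_i F i = F 0 + F 1.
Proof.
by rewrite !big_ord_recl big_ord0 addr0; congr (_ + F _); apply: val_inj.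
Qed.

Lemma mul2E m n (X : 'M[R]_(m, 2)) (Y : 'M[R]_(2, n)) i j :
  (X *m Y) i j = X i 0 * Y 0 j + X i 1 * Y 1 j.
Proof. by rewrite mxE sum2. Qed.

Lemma mxdotE X Y : X^T = X -> Y^T = Y -> mxdot X Y = (vec X *m (vec Y)^T) 0 0.
Proof.
move=> sX sY; rewrite dotE !vecE /mxdot /mxtrace sum2 !mul2E.
rewrite (sym01 sX) (sym01 sY).
rewrite [s2 * _ * _]mulrACA sqrt2_sq; ring.
Qed.

(** The Gram matrix of the polarization of twice the determinant.  It is an
    involution, and in the coordinates of [vec] it sends a matrix to its
    adjugate; this turns the trace pairing into the Lorentz form. *)
Definition J3 : 'M[R]_3 :=
  \matrix_(i, j)
    nth 0 (nth [::] [:: [:: 0; 1; 0]; [:: 1; 0; 0]; [:: 0; 0; -1]] i) j.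

Lemma J3_row x : x *m J3 = row3 (x 0 1) (x 0 0) (- x 0 2).
Proof. by apply: row3P; rewrite row3E mxE sum3 !mxE /=; ring. Qed.

Lemma J3_sym : J3^T = J3.
Proof.
by apply/matrixP; apply: ord3P => j; elim/ord3P: j; rewrite !mxE.
Qed.

Lemma J3_sq : J3 *m J3 = 1%:M.
Proof.
apply/row_matrixP => i; rewrite row_mul J3_row row1.
by elim/ord3P: i; apply: row3P; rewrite row3E !mxE //= ?opprK ?oppr0.
Qed.

Definition lor x y := (x *m J3 *m y^T) 0 0.

Lemma lorE x y : lor x y = x 0 0 * y 0 1 + x 0 1 * y 0 0 - x 0 2 * y 0 2.
Proof. by rewrite /lor J3_row dotE !row3E; ring. Qed.

Lemma lorC x y : lor x y = lor y x.
Proof. by rewrite !lorE; ring. Qed.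

Lemma dot_lor x y : (x *m y^T) 0 0 = lor x (y *m J3).
Proof. by rewrite /lor trmx_mul J3_sym mulmxA -(mulmxA x) J3_sq mulmx1. Qed.

Lemma det2E (S : comNzRingType) (X : 'M[S]_2) :
  \det X = X 0 0 * X 1 1 - X 0 1 * X 1 0.
Proof.
rewrite (expand_det_row _ 0) /cofactor !big_ord_recl big_ord0 /= !det_mx11 !mxE.
rewrite !expr0 !expr1 mul1r addr0 mulN1r mulrN.
by congr (_ * X _ _ - X _ _ * X _ _); apply: val_inj.
Qed.

Lemma lor_det X : X^T = X -> lor (vec X) (vec X) = 2 * \det X.
Proof.
move=> sX; rewrite lorE det2E !vecE (sym01 sX).
by rewrite [s2 * _ * _]mulrACA sqrt2_sq; ring.
Qed.

Definition cone x := [/\ 0 <= x 0 0, 0 <= x 0 1 & 0 <= lor x x].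

Lemma cone_trace x : 0 < x 0 0 + x 0 1 -> 0 <= lor x x -> cone x.
Proof.
rewrite lorE => tr q; have := sqr_ge0 (x 0 2); rewrite expr2 => h.
split; rewrite ?lorE // leNgt; apply/negP => lt0; nra.
Qed.

Lemma psd_cone X : psdmx X <-> X^T = X /\ cone (vec X).
Proof.
split=> [[sX pX]|[sX [p0 p1 pq]]]; split=> //.
  have form (v : 'rV[R]_2) : (v *m X *m v^T) 0 0 =
    X 0 0 * v 0 0 ^+ 2 + 2 * X 0 1 * v 0 0 * v 0 1 + X 1 1 * v 0 1 ^+ 2.
    by rewrite !mul2E !mxE (sym01 sX); ring.
  have pX' a b : 0 <= X 0 0 * a ^+ 2 + 2 * X 0 1 * a * b + X 1 1 * b ^+ 2.
    have := pX (\row_k (if k == 0 then a else b)); rewrite form !mxE /=.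
    by [].
  have p0 : 0 <= X 0 0 by have := pX' 1 0; lra.
  have p1 : 0 <= X 1 1 by have := pX' 0 1; lra.
  split; rewrite ?vecE // lor_det // det2E (sym01 sX).
  have h1 := pX' (- X 0 1) (X 0 0).
  have h2 := pX' (- X 1 1) (X 0 1).
  have h3 := pX' 1 (- X 0 1).
  have [e|n0] := eqVneq (X 0 0) 0; last first.
    have {n0 p0} : 0 < X 0 0 by rewrite lt_neqAle eq_sym n0.
    nra.
  rewrite e in h1 h2 h3 *.
  have := pX' (- (X 1 1 + 1)) (X 0 1).
  rewrite e; nra.
move=> v; rewrite !mul2E !mxE (sym01 sX).
rewrite !vecE lor_det // det2E (sym01 sX) in p0 p1 pq.
have [e|n0] := eqVneq (X 0 0) 0.
  have e1 : X 0 1 = 0 by nra.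
  rewrite e e1; nra.
have {n0 p0} lt0 : 0 < X 0 0 by rewrite lt_neqAle eq_sym n0.
rewrite -(pmulr_rge0 _ lt0).
have -> : X 0 0 * ((v 0 0 * X 0 0 + v 0 1 * X 0 1) * v 0 0 +
  (v 0 0 * X 0 1 + v 0 1 * X 1 1) * v 0 1) =
  (X 0 0 * v 0 0 + X 0 1 * v 0 1) ^+ 2 +
  (X 0 0 * X 1 1 - X 0 1 * X 0 1) * v 0 1 ^+ 2 by ring.
apply: addr_ge0; first exact: sqr_ge0.
by apply: mulr_ge0; [lra | exact: sqr_ge0].
Qed.

(** The form has signature one plus, two minus, so a vector orthogonal to a
    nonzero vector of the closed cone cannot be timelike. *)
Lemma cone_lor_perp u v : cone u -> u != 0 -> lor u v = 0 -> lor v v <= 0.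
Proof.
move=> [u0 u1 uu] nz uv; rewrite leNgt; apply/negP => vv.
rewrite !lorE in uu uv vv.
have pv : 0 < v 0 0 * v 0 1 by nra.
have e : (u 0 0 * v 0 1 + u 0 1 * v 0 0) ^+ 2 = (u 0 2 * v 0 2) ^+ 2.
  by congr (_ ^+ 2); lra.
have [z|nz01] := eqVneq (u 0 0 * u 0 1) 0.
  have z2 : u 0 2 = 0 by nra.
  have l : u 0 0 * v 0 1 + u 0 1 * v 0 0 = 0 by rewrite z2 mul0r in uv; lra.
  have [v0 v1] : v 0 0 != 0 /\ v 0 1 != 0.
    by split; apply: contraTneq pv => ->; rewrite ?mul0r ?mulr0 ltxx.
  case/negP: nz; apply/eqP; apply: row3P; rewrite ?mxE //.
    case: (eqVneq (u 0 1) 0) l => [->|n1 _].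
      by rewrite mul0r addr0 => /eqP; rewrite mulf_eq0 (negPf v1) orbF => /eqP.
    by move/eqP: z; rewrite mulf_eq0 (negPf n1) orbF => /eqP.
  case: (eqVneq (u 0 0) 0) l => [->|n0 _].
    by rewrite mul0r add0r => /eqP; rewrite mulf_eq0 (negPf v0) orbF => /eqP.
  by move/eqP: z; rewrite mulf_eq0 (negPf n0) => /eqP.
have p01 : 0 < u 0 0 * u 0 1 by rewrite lt_neqAle eq_sym nz01 mulr_ge0.
have h1 : (u 0 2 * v 0 2) ^+ 2 <= 2 * (u 0 0 * u 0 1) * (v 0 2) ^+ 2.
  rewrite exprMn ler_wpM2r ?sqr_ge0 //; lra.
have h2 : 2 * (u 0 0 * u 0 1) * (v 0 2) ^+ 2 <
          2 * (u 0 0 * u 0 1) * (2 * (v 0 0 * v 0 1)).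
  by rewrite ltr_pM2l; lra.
have := sqr_ge0 (u 0 0 * v 0 1 - u 0 1 * v 0 0).
lra.
Qed.

Lemma J3_K x : x *m J3 *m J3 = x.
Proof. by rewrite -mulmxA J3_sq mulmx1. Qed.

Lemma cone_J3 x : cone x -> cone (x *m J3).
Proof.
by move=> [x0 x1 xx]; rewrite J3_row; split; rewrite ?lorE ?row3E //;
   rewrite lorE in xx; lra.
Qed.

Lemma lor_J3 x y : lor (x *m J3) (y *m J3) = lor x y.
Proof. by rewrite !J3_row !lorE !row3E; ring. Qed.

Lemma lorNr x y : lor x (- y) = - lor x y.
Proof. by rewrite /lor linearN /= mulmxN mxE. Qed.

Lemma lorNN x y : lor (- x) (- y) = lor x y.
Proof. by rewrite lorNr lorC lorNr opprK lorC. Qed.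

Lemma dotBr x y z :
  (x *m (y - z)^T) 0 0 = (x *m y^T) 0 0 - (x *m z^T) 0 0.
Proof. by rewrite !dotE !mxE; ring. Qed.

Lemma cone_lor_ge0 x y : cone x -> cone y -> 0 <= lor x y.
Proof.
move=> [x0 x1 xx] [y0 y1 yy]; rewrite !lorE in xx yy *.
rewrite subr_ge0; apply: le_trans (ler_norm _) _.
have s0 : 0 <= x 0 0 * y 0 1 + x 0 1 * y 0 0 by rewrite addr_ge0 ?mulr_ge0.
rewrite -(ger0_norm s0) -ler_sqr ?nnegrE // ?normr_ge0 //.
rewrite !real_normK ?num_real //.
have h1 : (x 0 2 * y 0 2) ^+ 2 <= (2 * (x 0 0 * x 0 1)) * (2 * (y 0 0 * y 0 1)).
  rewrite exprMn; apply: ler_pM; rewrite ?sqr_ge0 //; lra.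
have := sqr_ge0 (x 0 0 * y 0 1 - x 0 1 * y 0 0).
lra.
Qed.

Lemma cone_dot_ge0 x y : cone x -> cone y -> 0 <= (x *m y^T) 0 0.
Proof. by move=> cx cy; rewrite dot_lor cone_lor_ge0 //; exact: cone_J3. Qed.

Lemma psd_vec X : psdmx X -> cone (vec X).
Proof. by case/psd_cone. Qed.

Lemma vec_inj X Y : X^T = X -> Y^T = Y -> vec X = vec Y -> X = Y.
Proof. by move=> sX sY e; rewrite -(vecK sX) e vecK. Qed.

End Coordinates.

(** * One-sided limits at zero *)

Section OneSidedLimits.
Variable R : realType.
Implicit Type f : {poly R}.

Lemma near_gt0 (F : R -> R) l :
  (F x @[x --> 0^'+] --> l)%classic -> 0 < l -> \forall x \near 0^'+, 0 < F x.
Proof. by move=> Fl l0; exact: (cvgr_gt _ Fl _ l0). Qed.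

Lemma horner_right f : f.[t] @[t --> 0^'+] --> f.[0].
Proof. exact/cvg_at_right_filter/continuous_horner. Qed.

Lemma near_affine_gt0 (a b : R) : 0 < a -> \forall e \near 0^'+, 0 < a + e * b.
Proof.
move=> a0; have hE t : (a%:P + b *: 'X).[t] = a + t * b.
  by rewrite !hornerE mulrC.
have := near_gt0 (@horner_right (a%:P + b *: 'X)).
by rewrite hE mul0r addr0 => /(_ a0); apply: filterS => t; rewrite hE.
Qed.

End OneSidedLimits.

(** * Binary quartics on the conic of light rays *)

Section Quartics.
Variable R : realType.
Implicit Types (x y : 'rV[R]_3) (K : 'M[R]_3) (f g : {poly R}) (z w : option R).

Local Notation s2 := (Num.sqrt (2 : R)).

(** The projective line, as the affine line with [None] at infinity, mapped onto
    the light rays: [vec] of the square of the vector [(1, s)], or [(0, 1)]. *)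
Definition veronese z : 'rV[R]_3 :=
  if z is Some s then row3 1 (s ^+ 2) (s2 * s) else row3 0 1 0.

(** The value at [z] of the homogenization of [f] to degree four. *)
Definition qval f z : R := if z is Some s then f.[s] else f`_4.

Definition ray x : option R :=
  if x 0 0 == 0 then None else Some (x 0 2 / (s2 * x 0 0)).

Lemma lightlike_ray x : cone x -> lor x x = 0 -> x != 0 ->
  exists2 c, 0 < c & x = c *: veronese (ray x).
Proof.
move=> [p0 p1 _] q nz; rewrite lorE in q; rewrite /ray.
have [e0|n0] := eqVneq (x 0 0) 0.
  have e2 : x 0 2 = 0 by nra.
  exists (x 0 1); last by apply: row3P; rewrite mxE row3E ?mulr0 ?mulr1.
  rewrite lt_neqAle p1 andbT eq_sym; apply: contraNneq nz => e1.
  by apply/eqP; apply: row3P; rewrite ?mxE.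
have n2 := sqrt2_neq0 R; have sq := sqrt2_sq R.
exists (x 0 0); first by rewrite lt_neqAle eq_sym n0.
apply: row3P; rewrite mxE row3E; [by rewrite mulr1| |].
- have -> : (x 0 2 / (s2 * x 0 0)) ^+ 2 =
            (x 0 2 * x 0 2) / ((s2 * s2) * (x 0 0 * x 0 0)).
    by field; apply/andP.
  rewrite sq; have -> : x 0 2 * x 0 2 = 2 * (x 0 0 * x 0 1) by lra.
  by field.
- by field; apply/andP.
Qed.

Lemma veronese_cone z : cone (veronese z).
Proof.
have sq := sqrt2_sq R.
case: z => [s|]; split; rewrite ?lorE ?row3E ?sqr_ge0 //;
  rewrite ?mul0r ?mulr0 ?mul1r ?addr0 ?subr0 //.
have -> : s2 * s * (s2 * s) = (s2 * s2) * s ^+ 2 by ring.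
by rewrite sq; lra.
Qed.

Lemma veronese_lightlike z : lor (veronese z) (veronese z) = 0.
Proof.
have sq := sqrt2_sq R.
case: z => [s|]; rewrite lorE !row3E; last by ring.
have -> : s2 * s * (s2 * s) = (s2 * s2) * s ^+ 2 by ring.
by rewrite sq; ring.
Qed.

Lemma veronese_neq0 z : veronese z != 0.
Proof.
case: z => [s|]; apply/eqP => /matrixP.
  by move=> /(_ 0 0)/eqP; rewrite row3E mxE oner_eq0.
by move=> /(_ 0 1)/eqP; rewrite row3E mxE oner_eq0.
Qed.

(** The restriction to the conic of the quadratic form with matrix [K]. *)
Definition quartic K : {poly R} := Poly
  [:: K 0 0; s2 * (K 0 2 + K 2 0); K 0 1 + K 1 0 + 2 * K 2 2;
      s2 * (K 1 2 + K 2 1); K 1 1].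

Lemma size_quartic K : (size (quartic K) <= 5)%N.
Proof. exact: size_Poly. Qed.

Lemma quarticE K z :
  qval (quartic K) z = (veronese z *m K *m (veronese z)^T) 0 0.
Proof.
rewrite dotE; rewrite ![(_ *m K) _ _]mxE !sum3.
case: z => [s|] /=; last by rewrite !row3E coef_Poly /=; ring.
rewrite /quartic horner_Poly /= !row3E.
by move: (sqrt2_sq R); move: s2 => r <-; ring.
Qed.

Lemma quartic_scaled K c z :
  ((c *: veronese z) *m K *m (c *: veronese z)^T) 0 0 =
  c ^+ 2 * qval (quartic K) z.
Proof.
rewrite quarticE linearZ /= -!scalemxAl -scalemxAr scalerA mxE expr2; ring.
Qed.

Lemma quartic_onto f : (size f <= 5)%N -> exists K, quartic K = f.
Proof.
move=> sf; have n2 := sqrt2_neq0 R.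
exists (\matrix_(i, j) nth 0 (nth [::]
  [:: [:: f`_0; f`_2; f`_1 / s2]; [:: 0; f`_4; f`_3 / s2]; [:: 0; 0; 0]] i) j).
apply/polyP => i; rewrite /quartic coef_Poly !mxE /=.
case: i => [|[|[|[|[|i]]]]] //=.
- by field.
- by ring.
- by field.
- by rewrite nth_default // nth_default // (leq_trans sf).
Qed.

(** An interpolation that needs no count of the zeros: dividing [f] by the
    power of the linear form vanishing at [z] removes that zero and no other,
    and what remains is positive at [z] once scaled.  The degree lost is made
    up by the homogenizing variable when [z] is finite, and by [X] when [z] is
    at infinity; either choice may add zeros, but not at [z]. *)
Lemma peak f z : (size f <= 5)%N -> f != 0 -> qval f z = 0 ->
  exists g, [/\ (size g <= 5)%N, 0 < qval g z &
    forall w, w != z -> qval f w = 0 -> qval g w = 0].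
Proof.
move=> sf f0; case: z => [s|] /= fz.
  have [m [q]] := multiplicity_XsubC f s.
  rewrite f0 /= => nrq def_f.
  have q0 : q != 0 by apply: contraNneq nrq => ->; rewrite root0.
  have m0 : (0 < m)%N.
    case: m def_f => // def_f; rewrite expr0 mulr1 in def_f.
    by rewrite -def_f /root fz eqxx in nrq.
  have sq : (size q <= 4)%N.
    move: sf; rewrite def_f size_Mmonic ?monic_exp ?monicXsubC //.
    rewrite size_exp_XsubC addnS /= => le5.
    by rewrite -ltnS (leq_trans _ le5) // -addn1 leq_add2l.
  exists (q.[s] *: q); split=> [||w].
  - by rewrite (leq_trans (size_scale_leq _ _)) // (leq_trans sq).
  - by rewrite hornerZ -expr2 exprn_even_gt0.
  case: w => [t|_ _] /=; last by rewrite coefZ [q`_4]nth_default ?mulr0.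
  rewrite hornerZ {1}def_f hornerM horner_exp hornerXsubC => nts /eqP.
  have {nts}ts : t != s by apply: contraNneq nts => ->.
  rewrite mulf_eq0 expf_eq0 subr_eq0 m0 (negPf ts) orbF => /eqP->.
  by rewrite mulr0.
exists (lead_coef f *: (f * 'X^(5 - size f))).
have sf0 : (0 < size f)%N by rewrite size_poly_gt0.
split=> [||[t _ /= ft|//]].
- rewrite (leq_trans (size_scale_leq _ _)) // size_Mmonic ?monicXn //.
  by rewrite size_polyXn addnS /= subnKC.
- rewrite coefZ coefMXn.
  have -> : (4 < 5 - size f)%N = false by lia.
  have -> : (4 - (5 - size f))%N = (size f).-1 by lia.
  by rewrite -lead_coefE -expr2 exprn_even_gt0 //= lead_coef_eq0.
- by rewrite hornerZ hornerM ft mul0r mulr0.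
Qed.

Lemma qvalD f g z : qval (f + g) z = qval f z + qval g z.
Proof. by case: z => [s|] /=; rewrite ?hornerD ?coefD. Qed.

Lemma qvalZ c f z : qval (c *: f) z = c * qval f z.
Proof. by case: z => [s|] /=; rewrite ?hornerZ ?coefZ. Qed.

Lemma qval_sum (I : finType) (F : I -> {poly R}) z :
  qval (\sum_i F i) z = \sum_i qval (F i) z.
Proof. by case: z => [s|] /=; rewrite ?horner_sum ?coef_sum. Qed.

(** Weak sign conditions on a nonzero quartic can be made strict.  At each zero
    [z i] among the prescribed points add a small multiple of a quartic with
    the wanted sign there and vanishing at the other zeros of [f]; no two such
    corrections conflict. *)
Lemma strict_signs (T : finType) (P : pred T) (z : T -> option R)
    (sg : T -> R) f :
  (size f <= 5)%N -> f != 0 ->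
  (forall i, P i -> sg i != 0) ->
  (forall i j, P i -> P j -> z i = z j -> sg i = sg j) ->
  (forall i, P i -> 0 <= sg i * qval f (z i)) ->
  exists g, [/\ (size g <= 5)%N, g != 0 &
    forall i, P i -> 0 < sg i * qval g (z i)].
Proof.
move=> sf f0 sg0 sgz fge0.
have /boolp.choice[G GP] : forall i, exists g : {poly R}, [/\ (size g <= 5)%N,
    qval f (z i) = 0 -> 0 < qval g (z i) &
    forall w, w != z i -> qval f w = 0 -> qval g w = 0].
  move=> i; have [e|ne] := eqVneq (qval f (z i)) 0.
    by have [g [? ? ?]] := peak sf f0 e; exists g.
  exists 0; split=> [||w _ _]; rewrite ?size_poly0 //.
    by move=> e; rewrite e eqxx in ne.
  by case: w => [s|] /=; rewrite ?horner0 ?coef0.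
pose Z i := P i && (qval f (z i) == 0).
pose h := \sum_i (if Z i then sg i else 0) *: G i.
have hpos i : Z i -> 0 < sg i * qval h (z i).
  move=> Zi; have /andP[Pi /eqP fi] := Zi.
  have [_ /(_ fi) Gi _] := GP i.
  rewrite qval_sum (bigD1 i) //= mulrDr Zi qvalZ mulrA -expr2.
  apply: ltr_pwDl; first by rewrite mulr_gt0 // exprn_even_gt0 //= sg0.
  rewrite mulr_sumr sumr_ge0 // => j _; rewrite qvalZ.
  case Zj: (Z j); last by rewrite mul0r mulr0.
  have /andP[Pj /eqP fj] := Zj; have [_ /(_ fj) Gj Gj0] := GP j.
  have [e|ne] := eqVneq (z i) (z j).
    by rewrite (sgz i j) // e mulrA -expr2 mulr_ge0 ?sqr_ge0 // ltW.
  by rewrite (Gj0 (z i)) // !mulr0.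
have sh : (size h <= 5)%N.
  rewrite /h; elim/big_ind: _ => [|u v su sv|i _]; first by rewrite size_poly0.
    by rewrite (leq_trans (size_polyD _ _)) // geq_max su.
  by rewrite (leq_trans (size_scale_leq _ _)) //; have [] := GP i.
have l0 : 0 < lead_coef f ^+ 2 by rewrite exprn_even_gt0 //= lead_coef_eq0.
have near_e : \forall e \near 0^'+,
    (forall i, P i -> 0 < sg i * qval (f + e *: h) (z i)) /\
    0 < lead_coef f ^+ 2 + e * (lead_coef f * h`_(size f).-1) /\ 0 < e.
  near=> e; split; last split; near: e.
  2: exact: near_affine_gt0.
  2: exact: nbhs_right_gt.
  apply: filter_forall => i; case: (boolP (P i)) => [Pi|_]; last exact: nearW.
  have [fi|nfi] := eqVneq (qval f (z i)) 0.
    near=> e => _; rewrite qvalD qvalZ fi add0r mulrCA mulr_gt0 //.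
    by rewrite hpos // /Z Pi fi eqxx.
  have lt0 : 0 < sg i * qval f (z i).
    by rewrite lt_neqAle fge0 // andbT eq_sym mulf_neq0 // sg0.
  have := near_affine_gt0 (sg i * qval h (z i)) lt0.
  by apply: filterS => e; rewrite qvalD qvalZ mulrDr mulrCA.
have [e [he1 [he2 e0]]] := filter_ex near_e.
exists (f + e *: h); split=> //.
  rewrite (leq_trans (size_polyD _ _)) // geq_max sf.
  by rewrite (leq_trans (size_scale_leq _ _)).
apply: contraTneq he2 => /polyP/(_ (size f).-1).
rewrite coefD coefZ coef0 -lead_coefE => e1.
have -> : lead_coef f ^+ 2 + e * (lead_coef f * h`_(size f).-1) =
  lead_coef f * (lead_coef f + e * h`_(size f).-1) by ring.
by rewrite e1 mulr0 ltxx.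
Unshelve. all: by end_near.
Qed.

Lemma quartic_neq0P f : f != 0 -> exists s, f.[s] != 0.
Proof.
move=> f0; apply: contra_notP (negP f0) => /boolp.forallNP all0; apply/eqP.
apply: (@roots_geq_poly_eq0 _ f [seq i%:R | i <- iota 0 (size f)]).
- apply/allP => t _; apply/eqP; apply: contra_notP (all0 t) => nt.
  exact/eqP.
- by rewrite map_inj_uniq ?iota_uniq // => i j /eqP; rewrite eqr_nat => /eqP.
- by rewrite size_map size_iota.
Qed.

End Quartics.

(** * Linear maps and the light cone *)

Section Conformal.
Variable R : realType.
Implicit Types (x y : 'rV[R]_3) (K D G : 'M[R]_3).

Local Notation s2 := (Num.sqrt (2 : R)).
Local Notation J := (J3 R).

Lemma lightlike_square x : cone x -> lor x x = 0 ->
  exists u0 u1, x = row3 (u0 ^+ 2) (u1 ^+ 2) (s2 * (u0 * u1)).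
Proof.
move=> cx lx; have [->|nz] := eqVneq x 0.
  by exists 0, 0; apply: row3P; rewrite row3E mxE ?expr2 !mulr0.
have [c c0 ->] := lightlike_ray cx lx nz.
have sq := sqr_sqrtr (ltW c0); rewrite -{1}sq; move: (Num.sqrt c) => r.
case: (ray x) => [s|] /=.
  by exists r, (r * s); apply: row3P; rewrite mxE !row3E; ring.
by exists 0, r; apply: row3P; rewrite mxE !row3E; ring.
Qed.

Lemma lightlike_coneN x : lor x x = 0 -> cone x \/ cone (- x).
Proof.
move=> lx; have lN : lor (- x) (- x) = 0 by rewrite -lx !lorE !mxE; ring.
rewrite /cone lx lN !mxE lexx; rewrite lorE in lx.
rewrite !oppr_ge0; have [h|h|h] := ltgtP 0 (x 0 0).
- by left; split=> //; rewrite leNgt; apply/negP => h1; nra.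
- by right; split=> //; rewrite leNgt; apply/negP => h1; nra.
- by case: (lerP 0 (x 0 1)) => h1; [left | right]; split; rewrite // ltW.
Qed.

(** A linear map that multiplies the Lorentz form by a positive number and
    respects the cone is a congruence.  The images of the two diagonal rank-one
    matrices are squares of vectors [u] and [v]; the image of the off-diagonal
    matrix is orthogonal to both, hence is the symmetrized product of [u] and
    [v] up to a factor that the form forces to be a sign, and that sign can be
    moved into [v]. *)
Lemma conformal_congruence G (k : R) : 0 < k -> G *m J *m G^T = k *: J ->
  cone (row 0 G) -> cone (row 1 G) ->
  exists2 S : 'M[R]_2, S \in unitmx &
    forall X, X^T = X -> vec (S^T *m X *m S) = vec X *m G.
Proof.
move=> k0 GJ c0 c1.
have rowG i j : lor (row i G) (row j G) = k * J i j.
  have -> : k * J i j = (G *m J *m G^T) i j by rewrite GJ [RHS]mxE.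
  rewrite /lor -row_mul [LHS]mxE [RHS]mxE.
  by apply: eq_bigr => l _; rewrite !mxE.
have [l00 l11] : lor (row 0 G) (row 0 G) = 0 /\ lor (row 1 G) (row 1 G) = 0.
  by rewrite !rowG !mxE /=; split; ring.
have l01 : lor (row 0 G) (row 1 G) = k by rewrite rowG mxE /= mulr1.
have l20 : lor (row 2 G) (row 0 G) = 0 by rewrite rowG mxE /= mulr0.
have l21 : lor (row 2 G) (row 1 G) = 0 by rewrite rowG mxE /= mulr0.
have l22 : lor (row 2 G) (row 2 G) = - k by rewrite rowG mxE /= mulrN1.
have [u0 [u1 eu]] := lightlike_square c0 l00.
have [v0 [v1 ev]] := lightlike_square c1 l11.
have sq := sqrt2_sq R; set r := s2 in sq eu ev.
pose d := u0 * v1 - u1 * v0.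
have kd : k = d ^+ 2.
  rewrite -l01 eu ev lorE !row3E.
  have -> : r * (u0 * u1) * (r * (v0 * v1)) = (r * r) * (u0 * u1 * v0 * v1).
    by ring.
  by rewrite sq /d; ring.
have d0 : d != 0.
  by apply: contraTneq k0; rewrite kd => ->; rewrite expr2 mulr0 ltxx.
pose h := row3 (r * (u0 * v0)) (r * (u1 * v1)) (u0 * v1 + u1 * v0).
have lhh : lor h h = - d ^+ 2.
  rewrite lorE !row3E.
  have -> : r * (u0 * v0) * (r * (u1 * v1)) = (r * r) * (u0 * u1 * v0 * v1).
    by ring.
  have -> : r * (u1 * v1) * (r * (u0 * v0)) = (r * r) * (u0 * u1 * v0 * v1).
    by ring.
  by rewrite sq /d; ring.
(* The two light vectors and their symmetrized product [h] form an orthogonal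
   basis up to the pairing of the first two, which equals [d ^+ 2]; the three
   hints below are the multiples of [r * r = 2] that each coordinate needs. *)
have expand x : d ^+ 2 *: x = lor x (row 1 G) *: row 0 G +
    lor x (row 0 G) *: row 1 G - lor x h *: h.
  apply: row3P; rewrite eu ev !mxE !lorE !row3E /= /d.
  - pose m := x 0 0 * (u0 * u1 * v0 * v1) + x 0 1 * (u0 * v0) ^+ 2.
    by have := congr1 ( *%R m) sq; rewrite /m; lra.
  - pose m := x 0 1 * (u0 * u1 * v0 * v1) + x 0 0 * (u1 * v1) ^+ 2.
    by have := congr1 ( *%R m) sq; rewrite /m; lra.
  - pose m := x 0 2 * (u0 * u1 * v0 * v1).
    by have := congr1 ( *%R m) sq; rewrite /m; lra.
pose c := - lor (row 2 G) h / d ^+ 2.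
have g2 : row 2 G = c *: h.
  apply: (scalerI (a := d ^+ 2)); first by rewrite expf_neq0.
  rewrite expand l20 l21 !scale0r !add0r scalerA /c mulrC.
  by rewrite divfK ?expf_neq0 // scaleNr.
have cc : c * c = 1.
  have lc : lor (c *: h) (c *: h) = (c * c) * lor h h.
    by rewrite !lorE !mxE; ring.
  have /eqP := l22; rewrite g2 lc lhh kd mulrN eqr_opp => /eqP e.
  by apply: (mulIf (expf_neq0 2 d0)); rewrite e mul1r.
have c_neq0 : c != 0.
  by apply/eqP => e; move/eqP: cc; rewrite e mulr0 eq_sym oner_eq0.
pose S : 'M[R]_2 := \matrix_(i, j)
  (if i == 0 then (if j == 0 then u0 else u1)
   else c * (if j == 0 then v0 else v1)).
exists S.
  rewrite unitmxE det2E !mxE /= unitfE.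
  have -> : u0 * (c * v1) - u1 * (c * v0) = c * d by rewrite /d; ring.
  by rewrite mulf_neq0.
move=> X sX.
have vG j : (vec X *m G) 0 j =
    vec X 0 0 * row 0 G 0 j + vec X 0 1 * row 1 G 0 j + vec X 0 2 * row 2 G 0 j.
  by rewrite mxE sum3 ![row _ _ _ _]mxE.
apply: row3P; rewrite vG g2 eu ev [(c *: h) _ _]mxE !row3E ?vecE !mul2E
  ![S^T _ _]mxE ![S _ _]mxE /= (sym01 sX) -/r.
- have -> : r * X 0 1 * (c * (r * (u0 * v0))) = (r * r) * (c * X 0 1 * u0 * v0).
    by ring.
  rewrite sq.
  have -> : v0 ^+ 2 = (c * c) * v0 ^+ 2 by rewrite cc mul1r.
  by ring.
- have -> : r * X 0 1 * (c * (r * (u1 * v1))) = (r * r) * (c * X 0 1 * u1 * v1).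
    by ring.
  rewrite sq.
  have -> : v1 ^+ 2 = (c * c) * v1 ^+ 2 by rewrite cc mul1r.
  by ring.
- have -> : r * (v0 * v1) = (c * c) * (r * (v0 * v1)) by rewrite cc mul1r.
  by ring.
Qed.

Definition qform K x := (x *m K *m x^T) 0 0.

Lemma qform_lightlike K x :
  quartic K = 0 -> cone x -> lor x x = 0 -> qform K x = 0.
Proof.
move=> K0 cx lx; have [->|nz] := eqVneq x 0.
  by rewrite /qform !mul0mx mxE.
have [c _ ->] := lightlike_ray cx lx nz.
rewrite /qform quartic_scaled K0.
by case: (ray x) => [s|] /=; rewrite ?horner0 ?coef0 mulr0.
Qed.

(** The quadratic forms vanishing on the light cone are the multiples of the
    Lorentz form: the conic is irreducible. *)
Lemma quartic_eq0 K : quartic K = 0 -> K + K^T = (K 0 1 + K 1 0) *: J.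
Proof.
move=> /polyP K0; have n2 := sqrt2_neq0 R.
have := K0 0%N; have := K0 1%N; have := K0 2%N; have := K0 3%N; have := K0 4%N.
rewrite /quartic !coef_Poly !coef0 /= => e4 e3 e2 e1 e0.
move/eqP: e3; rewrite mulf_eq0 (negPf n2) /= => /eqP e3.
move/eqP: e1; rewrite mulf_eq0 (negPf n2) /= => /eqP e1.
apply/matrixP; apply: ord3P; apply: ord3P; rewrite !mxE /=; lra.
Qed.

Lemma lor_mul D x y : lor (x *m D) y = (x *m (D *m J) *m y^T) 0 0.
Proof. by rewrite /lor !mulmxA. Qed.

Lemma qform_DJ D x : qform (D *m J) x = lor x (x *m D).
Proof. by rewrite lorC lor_mul. Qed.

Lemma qform_DJD D x : qform (D *m J *m D^T) x = lor (x *m D) (x *m D).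
Proof. by rewrite /lor /qform trmx_mul !mulmxA. Qed.

Lemma qform_DJ_dual D x : qform (D *m J) (x *m J) = lor x (x *m D^T).
Proof.
rewrite /lor /qform !trmx_mul trmxK J3_sym !mulmxA.
by rewrite -(mulmxA _ J J) J3_sq mulmx1.
Qed.

(** A generator acts by its transpose on the dual side.  When it preserves the
    light cone to first order, the second order terms of the two sides agree
    through the identification by [J], so only one of them needs attention. *)
Lemma conformal_dual D (k : R) x : D *m J + J *m D^T = k *: J ->
  lor (x *m D^T) (x *m D^T) = lor (x *m J *m D) (x *m J *m D).
Proof.
move=> DJ.
have e1 : J *m D^T = k *: J - D *m J by rewrite -DJ addrC addKr.
have e2 : D^T *m J = k *: J - J *m D.
  have -> : D^T *m J = J *m (J *m D^T) *m J by rewrite mulmxA J3_sq mul1mx.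
  rewrite e1 mulmxBr mulmxBl -scalemxAr J3_sq -scalemxAl mul1mx.
  by rewrite -!mulmxA J3_sq mulmx1.
rewrite /lor !trmx_mul trmxK J3_sym; congr (_ 0 0).
rewrite -!mulmxA; congr (x *m _); rewrite !mulmxA; congr (_ *m x^T).
rewrite e2 mulmxBl -scalemxAl.
have -> : J *m D *m J *m D^T *m J = J *m D *m (J *m D^T) *m J.
  by rewrite !mulmxA.
rewrite e1 mulmxBr mulmxBl -scalemxAr -scalemxAl -!mulmxA J3_sq.
by rewrite !mulmx1.
Qed.

Definition congruence_mx (S : 'M[R]_2) : 'M[R]_3 :=
  \matrix_k vec (S^T *m unvec (delta_mx 0 k) *m S).

Lemma mul_congruence_mx S x : x *m congruence_mx S = vec (S^T *m unvec x *m S).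
Proof.
have E k l : congruence_mx S k l = vec (S^T *m unvec (delta_mx 0 k) *m S) 0 l.
  by rewrite /congruence_mx mxE.
apply: row3P; rewrite mxE sum3 !E !vecE !mul2E ![S^T _ _]mxE !unvecE !mxE /=;
  ring.
Qed.

Lemma lor_congruence_mx S x :
  lor (x *m congruence_mx S) (x *m congruence_mx S) = \det S ^+ 2 * lor x x.
Proof.
rewrite mul_congruence_mx lor_det; last first.
  by rewrite !trmx_mul trmxK unvec_sym mulmxA.
rewrite !det_mulmx det_tr -[X in lor X X]unvecK lor_det ?unvec_sym //; ring.
Qed.

End Conformal.

(** * The inequalities of an infinitesimal motion *)

Section Minors.
Variable R : realType.
Implicit Types (x dx : 'rV[R]_3) (X dX : 'M[R]_2) (f : {poly R}) (t : R).

Lemma det_mxsub1 (S : comNzRingType) n (h : 'I_n -> 'I_2) k (Y : 'M[S]_2) :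
  n = 1%N -> (forall i, h i = k) -> \det (mxsub h h Y) = Y k k.
Proof. by move=> n1 hk; subst n; rewrite det_mx11 mxE hk. Qed.

Lemma det_mxsub2 (S : comNzRingType) n (h : 'I_n -> 'I_2) (Y : 'M[S]_2) :
  n = 2%N -> injective h -> \det (mxsub h h Y) = \det Y.
Proof.
move=> n2 inj_h; subst n; rewrite !det2E !mxE.
have : h 0 != h 1 by rewrite inj_eq.
elim/ord2P: (h 0); elim/ord2P: (h 1) => // _.
by rewrite mulrC [X in _ - X]mulrC.
Qed.

Lemma principal_minor1 (S : comNzRingType) k (Y : 'M[S]_2) :
  principal_minor [set k]%SET Y = Y k k.
Proof.
apply: det_mxsub1 => [|i]; first exact: cards1.
by have := enum_valP i; rewrite inE => /eqP.
Qed.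

Lemma principal_minorT (S : comNzRingType) (Y : 'M[S]_2) :
  principal_minor [set: 'I_2]%SET Y = \det Y.
Proof.
apply: det_mxsub2; [by rewrite cardsT card_ord | exact: enum_val_inj].
Qed.

Lemma set_ord2P (I : {set 'I_2}) : I != finset.set0 ->
  (exists k, I = [set k]%SET) \/ I = [set: 'I_2]%SET.
Proof.
rewrite -card_gt0 => cI; have : (#|I| <= 2)%N.
  by rewrite -[X in (_ <= X)%N]card_ord max_card.
rewrite leq_eqVlt ltnS => /orP[/eqP e|l1].
  by right; apply/eqP; rewrite eqEcard finset.subsetT cardsT card_ord e.
by left; apply/cards1P; rewrite eqn_leq l1.
Qed.

Lemma taylorE s f : taylor s f = \sum_(k < s.+1) f`_k *: 'X^k.
Proof.
apply: eq_bigr => k _.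
by rewrite horner_coef0 coef_nderivn addn0 binn mulr1n.
Qed.

Lemma taylor1_eval f t : (taylor 1 f).[t] = f`_0 + t * f`_1.
Proof.
by rewrite taylorE !big_ord_recl big_ord0 !hornerE /=; ring.
Qed.

Lemma taylor2_eval f t : (taylor 2 f).[t] = f`_0 + t * f`_1 + t ^+ 2 * f`_2.
Proof.
by rewrite taylorE !big_ord_recl big_ord0 !hornerE /=; ring.
Qed.

Lemma line_mxE X dX i j : line_mx X dX i j = (X i j)%:P + dX i j *: 'X.
Proof. by rewrite !mxE -mul_polyC mulrC. Qed.

Lemma line_det X dX : \det (line_mx X dX) = (\det X)%:P +
  (X 0 0 * dX 1 1 + X 1 1 * dX 0 0 - X 0 1 * dX 1 0 - X 1 0 * dX 0 1) *: 'X +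
  \det dX *: 'X^2.
Proof.
rewrite !det2E !line_mxE -!mul_polyC !polyCD !polyCN !polyCM.
by ring.
Qed.

(** The inequalities defining an [s]-infinitesimal motion, for [s] one or two,
    in the coordinates given by [vec]; the last one is doubled. *)
Definition motion_ineqs (s : nat) x dx t :=
  [/\ 0 <= x 0 0 + t * dx 0 0, 0 <= x 0 1 + t * dx 0 1 &
      0 <= lor x x + t * (2 * lor x dx) + (s == 2%N)%:R * t ^+ 2 * lor dx dx].

Lemma taylor_minorsP s X dX t : s = 1%N \/ s = 2%N -> X^T = X -> dX^T = dX ->
  (forall I : {set 'I_2}, I != finset.set0 ->
     0 <= (taylor s (principal_minor I (line_mx X dX))).[t]) <->
  motion_ineqs s (vec X) (vec dX) t.
Proof.
move=> s12 sX sdX.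
have diag k : (taylor s (principal_minor [set k]%SET (line_mx X dX))).[t] =
    X k k + t * dX k k.
  rewrite principal_minor1 line_mxE.
  case: s12 => ->; rewrite ?taylor1_eval ?taylor2_eval;
    by rewrite !coefD !coefZ !coefC !coefX /=; ring.
have full :
    2 * (taylor s (principal_minor [set: 'I_2]%SET (line_mx X dX))).[t] =
    lor (vec X) (vec X) + t * (2 * lor (vec X) (vec dX)) +
    (s == 2%N)%:R * t ^+ 2 * lor (vec dX) (vec dX).
  rewrite principal_minorT line_det !lor_det //.
  have -> : lor (vec X) (vec dX) =
     X 0 0 * dX 1 1 + X 1 1 * dX 0 0 - X 0 1 * dX 1 0 - X 1 0 * dX 0 1.
    rewrite lorE !vecE (sym01 sX) (sym01 sdX) [_ * X 0 1 * _]mulrACA sqrt2_sq.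
    by ring.
  case: s12 => ->; rewrite ?taylor1_eval ?taylor2_eval;
    by rewrite !coefD !coefZ !coefC !coefX !coefXn /=; ring.
split=> [H|[h0 h1 hd] I /set_ord2P[[k ->]|->]].
- have n0 k : [set k]%SET != finset.set0 by rewrite -card_gt0 cards1.
  have nT : [set: 'I_2]%SET != finset.set0 by rewrite -card_gt0 cardsT card_ord.
  split; rewrite ?vecE -?diag; [exact: H | exact: H |].
  by rewrite -full pmulr_rge0 //; apply: H.
- by rewrite diag; rewrite !vecE in h0 h1; elim/ord2P: k.
- by rewrite -(pmulr_rge0 _ (ltr0n _ 2)) full.
Qed.

(** Off the light cone the inequalities hold by continuity.  On it, the first
    nonzero term of the determinant decides its sign; and if a diagonal entry
    vanishes, the vector is a multiple of a coordinate vector, whose product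
    with [dx] is the derivative of that entry up to a positive factor. *)
Lemma near_motion_ineqs s x dx : cone x -> (x = 0 -> dx = 0) ->
  (lor x x = 0 ->
     0 <= lor x dx /\ (lor x dx = 0 -> s = 2%N -> 0 <= lor dx dx)) ->
  exists2 e, 0 < e & forall t, 0 <= t < e -> motion_ineqs s x dx t.
Proof.
move=> [x0 x1 xx] xz xl.
suff : \forall t \near 0^'+, motion_ineqs s x dx t.
  rewrite near_withinE => /nbhs_ballP[e /= e0 he].
  exists e => // t /andP[t0 te].
  move: t0; rewrite le_eqVlt => /orP[/eqP<-|t0].
    by split; rewrite ?expr2 !(mulr0, mul0r, addr0).
  by apply: he => //; rewrite -ball_normE /= sub0r normrN gtr0_norm.
have edge (i j : 'I_3) : (i, j) = (0, 1) \/ (i, j) = (1, 0) ->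
    \forall t \near 0^'+, 0 <= x 0 i + t * dx 0 i.
  move=> ij.
  have [xi0 xj0] : 0 <= x 0 i /\ 0 <= x 0 j by case: ij => -[-> ->].
  have [e|n] := eqVneq (x 0 i) 0; last first.
    have : 0 < x 0 i by rewrite lt_neqAle eq_sym n.
    by move/(@near_affine_gt0 _ _ (dx 0 i)); apply: filterS => t /ltW.
  have e2 : x 0 2 = 0.
    by rewrite lorE in xx; case: ij => -[ei ej]; rewrite ei in e; nra.
  have ll : lor x x = 0.
    by rewrite lorE e2; case: ij => -[ei ej]; rewrite ei in e; rewrite e; ring.
  have [p _] := xl ll.
  have pE : lor x dx = x 0 j * dx 0 i.
    rewrite lorE e2; case: ij => -[ei ej]; rewrite ei in e *;
      by rewrite ej e; ring.
  rewrite e; near=> t; rewrite add0r mulr_ge0 //.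
    have [ej|nj] := eqVneq (x 0 j) 0; last first.
      by rewrite pE pmulr_rge0 // in p; rewrite lt_neqAle eq_sym nj.
    rewrite xz ?mxE //; apply: row3P; rewrite mxE //.
      by case: ij => -[ei ej']; rewrite -?ei -?ej'.
    by case: ij => -[ei ej']; rewrite -?ei -?ej'.
suff minor : \forall t \near 0^'+,
    0 <= lor x x + t * (2 * lor x dx) + (s == 2%N)%:R * t ^+ 2 * lor dx dx.
  near=> t; split; near: t.
  - by apply: (edge 0 1); left.
  - by apply: (edge 1 0); right.
  - exact: minor.
pose p := (lor x x)%:P + (2 * lor x dx) *: 'X +
  ((s == 2%N)%:R * lor dx dx) *: 'X^2.
have pE t : p.[t] = lor x x + t * (2 * lor x dx) +
    (s == 2%N)%:R * t ^+ 2 * lor dx dx.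
  by rewrite /p !hornerD hornerC !hornerZ hornerX hornerXn; ring.
have [ll|n] := eqVneq (lor x x) 0; last first.
  have : 0 < p.[0].
    by rewrite pE expr2 !(mulr0, mul0r, addr0) lt_neqAle eq_sym n.
  by move/(near_gt0 (@horner_right _ p)); apply: filterS => t /ltW; rewrite pE.
have [l0 l2] := xl ll; rewrite ll.
have [l00|ln] := eqVneq (lor x dx) 0.
  rewrite l00; apply: nearW => t; rewrite mulr0 mulr0 !add0r.
  case: eqP => [s2|_]; last by rewrite !mul0r.
  by rewrite mul1r mulr_ge0 ?sqr_ge0 // l2.
have lgt : 0 < 2 * lor x dx by rewrite mulr_gt0 // lt_neqAle eq_sym ln.
have near_pos := near_affine_gt0 ((s == 2%N)%:R * lor dx dx) lgt.
near=> t.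
have -> : 0 + t * (2 * lor x dx) + (s == 2%N)%:R * t ^+ 2 * lor dx dx =
  t * (2 * lor x dx + t * ((s == 2%N)%:R * lor dx dx)) by ring.
by apply: mulr_ge0; apply: ltW => //; near: t.
Unshelve. all: by end_near.
Qed.

(** Dividing the determinant inequality by [t] and letting [t] tend to zero
    isolates the first order term; when it vanishes, a single positive [t]
    gives the sign of the second order one. *)
Lemma motion_ineqs_lightlike s x dx e : 0 < e ->
  (forall t, 0 <= t < e -> motion_ineqs s x dx t) -> lor x x = 0 ->
  0 <= lor x dx /\ (lor x dx = 0 -> s = 2%N -> 0 <= lor dx dx).
Proof.
move=> e0 H ll; split.
  rewrite leNgt; apply/negP => neg.
  have neg2 : 0 < - (2 * lor x dx) by rewrite oppr_gt0 pmulr_rlt0.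
  have : \forall t \near 0^'+, [/\ 0 < t, t < e &
     0 < - (2 * lor x dx) + t * (- ((s == 2%N)%:R * lor dx dx))].
    near=> t; split; [by []| by [] |].
    by near: t; apply: near_affine_gt0.
  case/filter_ex => t [t0 te ht].
  have [_ _] : motion_ineqs s x dx t by apply: H; rewrite ltW.
  rewrite ll => h; have := mulr_gt0 t0 ht; lra.
move=> l0 s2; have [_ _] : motion_ineqs s x dx (e / 2).
  by apply: H; apply/andP; split; lra.
rewrite ll l0 s2 eqxx mul1r mulr0 mulr0 !add0r.
by rewrite pmulr_rge0 // exprn_gt0 // divr_gt0.
Unshelve. all: by end_near.
Qed.

End Minors.

(** * Factorizations as products of frames *)

Section Factorizations.
Variable R : realType.

Definition frame p (A : 'I_p -> 'M[R]_2) : 'M[R]_(p, 3) :=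
  \matrix_(i, j) vec (A i) 0 j.

Lemma row_frame p (A : 'I_p -> 'M[R]_2) i : row i (frame A) = vec (A i).
Proof. by apply/rowP => j; rewrite !mxE. Qed.

Section Frames.
Variables (p q : nat) (M : 'M[R]_(p, q)).
Variables (A : 'I_p -> 'M[R]_2) (B : 'I_q -> 'M[R]_2).

Lemma frame_mulE i j :
  (frame A *m (frame B)^T) i j = (vec (A i) *m (vec (B j))^T) 0 0.
Proof. by rewrite !mxE; apply: eq_bigr => k _; rewrite !mxE. Qed.

Lemma factorization_frame :
  psd_factorization M A B <->
  [/\ forall i, psdmx (A i), forall j, psdmx (B j) &
      M = frame A *m (frame B)^T].
Proof.
split=> [[pA pB e]|[pA pB ->]]; split=> //.
  apply/matrixP => i j; rewrite e frame_mulE mxdotE //.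
    by case: (pA i).
  by case: (pB j).
by move=> i j; rewrite frame_mulE mxdotE //; [case: (pA i) | case: (pB j)].
Qed.

Lemma rank3_frames : \rank (frame A *m (frame B)^T) = 3%N ->
  row_full (frame A) /\ row_full (frame B).
Proof.
move=> r3; rewrite /row_full !eqn_leq !rank_leq_col /=; split.
  by have := mxrankM_maxl (frame A) (frame B)^T; rewrite r3.
by have := mxrankM_maxr (frame A) (frame B)^T; rewrite r3 mxrank_tr.
Qed.

Lemma frames_rank3 : row_full (frame A) -> row_full (frame B) ->
  \rank (frame A *m (frame B)^T) = 3%N.
Proof.
move=> fA fB; rewrite mxrankMfree; first exact/eqP.
by rewrite /row_free mxrank_tr.
Qed.

End Frames.

Lemma row_full_kernel m (V : 'M[R]_(m, 3)) :
  (forall v : 'rV_3, V *m v^T = 0 -> v = 0) -> row_full V.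
Proof.
move=> h; rewrite /row_full -mxrank_tr; apply: inj_row_free => v e.
by apply: h; apply: trmx_inj; rewrite trmx_mul trmxK trmx0.
Qed.

Lemma full_row_witness m (A : 'I_m -> 'M[R]_2) (v : 'rV[R]_3) :
  row_full (frame A) -> v != 0 -> exists i, (vec (A i) *m v^T) 0 0 != 0.
Proof.
move=> fA; apply: contra_neqP => /boolp.forallNP all0.
have /row_fullP[L LA] := fA.
have Av : frame A *m v^T = 0.
  apply/row_matrixP => i; rewrite row_mul row_frame row0.
  apply/matrixP => a b; rewrite !ord1 [RHS]mxE; apply/eqP.
  by apply: contra_notT (all0 i).
by apply: trmx_inj; rewrite trmx0 -[v^T]mul1mx -LA -mulmxA Av mulmx0.
Qed.

(** Factors of size at most one give a matrix of rank at most one. *)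
Lemma psd_rank_gt1 p q (M : 'M[R]_(p, q)) k :
  (1 < \rank M)%N -> has_psd_factorization k M -> (2 <= k)%N.
Proof.
move=> rM [A [B [_ _ eM]]]; rewrite leqNgt; apply: contraL rM => k1.
rewrite -leqNgt; case: k A B eM k1 => [|[|//]] A B eM _.
  have -> : M = 0; last by rewrite mxrank0.
  by apply/matrixP => i j; rewrite eM /mxdot /mxtrace big_ord0 mxE.
have -> : M = (\col_i A i 0 0) *m (\row_j B j 0 0).
  apply/matrixP => i j; rewrite eM /mxdot /mxtrace big_ord1 !mxE !big_ord1.
  by rewrite !mxE; congr (A i _ _ * B j _ _); apply: val_inj.
exact: leq_trans (mxrankM_maxl _ _) (rank_leq_col _).
Qed.

Lemma factorization_rank3_psd_rank2 p q (M : 'M[R]_(p, q)) A B :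
  psd_factorization M A B -> row_full (frame A) -> row_full (frame B) ->
  rank3_psd_rank2 M.
Proof.
move=> HAB fA fB; have /factorization_frame[pA pB eM] := HAB.
have rM : \rank M = 3%N by rewrite eM frames_rank3.
split=> // [i j|].
  rewrite eM frame_mulE cone_dot_ge0 //.
    by have /psd_cone[] := pA i.
  by have /psd_cone[] := pB j.
split; first by exists A, B.
by move=> k; apply: psd_rank_gt1; rewrite rM.
Qed.

Lemma given_by_frame (D : 'M[R]_3) p q (A dA : 'I_p -> 'M[R]_2)
    (B dB : 'I_q -> 'M[R]_2) :
  given_by D A B dA dB <->
  frame dA = frame A *m D /\ frame dB = - (frame B *m D^T).
Proof.
have tB j : (vec (dB j))^T = - (D *m (vec (B j))^T) <->
            vec (dB j) = - (vec (B j) *m D^T).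
  split=> [e|->]; last by rewrite linearN /= trmx_mul trmxK.
  by rewrite -[vec _]trmxK e linearN /= trmx_mul trmxK.
split=> -[eA eB]; split.
- by apply/row_matrixP => i; rewrite row_mul !row_frame.
- by apply/row_matrixP => j; rewrite linearN /= row_mul !row_frame; apply/tB.
- by move=> i; rewrite -!row_frame eA row_mul.
- by move=> j; apply/tB; rewrite -!row_frame eB linearN /= row_mul.
Qed.

End Factorizations.

(** * Infinitesimal motions and their generators *)

Section Motions.
Variable R : realType.
Variables (p q : nat).
Implicit Types (A dA : 'I_p -> 'M[R]_2) (B dB : 'I_q -> 'M[R]_2).
Implicit Types (D : 'M[R]_3) (s : nat).

Definition pairing_preserved A B dA dB :=
  frame dA *m (frame B)^T + frame A *m (frame dB)^T = 0.

Lemma pairing_preservedP A B dA dB :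
  (forall i, (A i)^T = A i) -> (forall j, (B j)^T = B j) ->
  (forall i, (dA i)^T = dA i) -> (forall j, (dB j)^T = dB j) ->
  (forall i j, mxdot (dA i) (B j) + mxdot (A i) (dB j) = 0) <->
  pairing_preserved A B dA dB.
Proof.
move=> sA sB sdA sdB; split=> [e|/matrixP e i j].
  by apply/matrixP => i j; rewrite mxE !frame_mulE -!mxdotE // e mxE.
by have := e i j; rewrite mxE !frame_mulE -!mxdotE // => ->; rewrite mxE.
Qed.

Lemma inf_motionP s A B dA dB : s = 1%N \/ s = 2%N ->
  (forall i, (A i)^T = A i) -> (forall j, (B j)^T = B j) ->
  inf_motion s A B dA dB <->
  [/\ forall i, (dA i)^T = dA i, forall j, (dB j)^T = dB j,
      pairing_preserved A B dA dB &
      exists2 e, 0 < e & forall t, 0 <= t < e ->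
        (forall i, motion_ineqs s (vec (A i)) (vec (dA i)) t) /\
        (forall j, motion_ineqs s (vec (B j)) (vec (dB j)) t)].
Proof.
move=> s12 sA sB; split=> -[sdA sdB pr [e e0 he]]; split=> //.
- exact/pairing_preservedP.
- exists e => // t te; split=> i; apply/taylor_minorsP => // I I0.
    by have [] := he t te I I0.
  by have [] := he t te I I0.
- exact/pairing_preservedP.
- exists e => // t te I I0; have [hA hB] := he t te.
  by split=> i; move: I I0; apply/taylor_minorsP.
Qed.

Definition motionA D A i := unvec (vec (A i) *m D).
Definition motionB D B j := unvec (- (vec (B j) *m D^T)).

Lemma frame_motionA D A : frame (motionA D A) = frame A *m D.
Proof. by apply/row_matrixP => i; rewrite row_mul !row_frame unvecK. Qed.

Lemma frame_motionB D B : frame (motionB D B) = - (frame B *m D^T).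
Proof.
by apply/row_matrixP => j; rewrite linearN /= row_mul !row_frame unvecK.
Qed.

Lemma motion_given_by D A B : given_by D A B (motionA D A) (motionB D B).
Proof. by apply/given_by_frame; rewrite frame_motionA frame_motionB. Qed.

Lemma uniform_eps (T : finType) (P : T -> R -> Prop) :
  (forall i, exists2 e, 0 < e & forall t, 0 <= t < e -> P i t) ->
  exists2 e, 0 < e & forall t, 0 <= t < e -> forall i, P i t.
Proof.
move=> H; have /boolp.choice[e he] : forall i, exists e, 0 < e /\
    forall t, 0 <= t < e -> P i t by move=> i; have [e] := H i; exists e.
have : \forall d \near 0^'+, 0 < d /\ forall i, d < e i.
  near=> d; split=> //; near: d; apply: filter_forall => i.
  by apply: nbhs_right_lt; case: (he i).
case/filter_ex => d [d0 de]; exists d => // t /andP[t0 td] i.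
by case: (he i) => _; apply; rewrite t0 (lt_trans td).
Unshelve. all: by end_near.
Qed.

(** Interior factors tolerate any small displacement, so only lightlike factors
    constrain [D]: to first order, and to second order where the first order
    vanishes. *)
Lemma motion_of s D A B : s = 1%N \/ s = 2%N ->
  (forall i, psdmx (A i)) -> (forall j, psdmx (B j)) ->
  (forall i, lor (vec (A i)) (vec (A i)) = 0 ->
    0 <= lor (vec (A i)) (vec (A i) *m D) /\
    (lor (vec (A i)) (vec (A i) *m D) = 0 -> s = 2%N ->
     0 <= lor (vec (A i) *m D) (vec (A i) *m D))) ->
  (forall j, lor (vec (B j)) (vec (B j)) = 0 ->
    0 <= lor (vec (B j)) (- (vec (B j) *m D^T)) /\
    (lor (vec (B j)) (- (vec (B j) *m D^T)) = 0 -> s = 2%N ->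
     0 <= lor (- (vec (B j) *m D^T)) (- (vec (B j) *m D^T)))) ->
  inf_motion s A B (motionA D A) (motionB D B).
Proof.
move=> s12 pA pB hA hB; apply/inf_motionP => //.
- by move=> i; case: (pA i).
- by move=> j; case: (pB j).
split=> [i|j||]; rewrite ?unvec_sym //.
  rewrite /pairing_preserved frame_motionA frame_motionB linearN /=.
  by rewrite trmx_mul trmxK mulmxN mulmxA subrr.
have [|eA eA0 heA] := @uniform_eps 'I_p
    (fun i t => motion_ineqs s (vec (A i)) (vec (motionA D A i)) t).
  move=> i; have /psd_cone[_ cA] := pA i.
  rewrite /motionA unvecK; apply: near_motion_ineqs => [//| -> |].
    by rewrite mul0mx.
  exact: hA.
have [|eB eB0 heB] := @uniform_eps 'I_q
    (fun j t => motion_ineqs s (vec (B j)) (vec (motionB D B j)) t).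
  move=> j; have /psd_cone[_ cB] := pB j.
  rewrite /motionB unvecK; apply: near_motion_ineqs => [//| -> |].
    by rewrite mul0mx oppr0.
  exact: hB.
exists (Num.min eA eB); first by rewrite lt_min eA0.
move=> t; rewrite lt_min => /and3P[t0 tA tB].
by split=> i; [apply: heA | apply: heB]; rewrite t0.
Qed.

Lemma motion_lightlike s D A B dA dB : s = 1%N \/ s = 2%N ->
  (forall i, (A i)^T = A i) -> (forall j, (B j)^T = B j) ->
  inf_motion s A B dA dB -> given_by D A B dA dB ->
  (forall i, lor (vec (A i)) (vec (A i)) = 0 ->
    0 <= lor (vec (A i)) (vec (A i) *m D) /\
    (lor (vec (A i)) (vec (A i) *m D) = 0 -> s = 2%N ->
     0 <= lor (vec (A i) *m D) (vec (A i) *m D))) /\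
  (forall j, lor (vec (B j)) (vec (B j)) = 0 ->
    0 <= lor (vec (B j)) (- (vec (B j) *m D^T))).
Proof.
move=> s12 sA sB /(inf_motionP _ _ s12 sA sB)[_ _ _ [e e0 he]].
move=> /given_by_frame[eA eB].
have vA i : vec (A i) *m D = vec (dA i) by rewrite -!row_frame eA row_mul.
have vB j : - (vec (B j) *m D^T) = vec (dB j).
  by rewrite -!row_frame eB linearN /= row_mul.
split=> i ll; [rewrite vA | rewrite vB].
  apply: (motion_ineqs_lightlike e0) => // t te.
  by case: (he t te).
by apply: (proj1 (motion_ineqs_lightlike e0 _ ll)) => t te; case: (he t te).
Qed.

(** Spanning frames can be cancelled: [D] is a left inverse of the first frame
    times the displacement of that frame, and the pairing identity forces the
    displacement of the second frame. *)
Lemma motion_generator A B dA dB : row_full (frame A) -> row_full (frame B) ->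
  pairing_preserved A B dA dB -> exists D, given_by D A B dA dB.
Proof.
move=> fA fB pr; set VA := frame A; set VB := frame B.
have /row_fullP[L LA] := fA; rewrite -/VA in LA.
have [N BN] : exists N, VB^T *m N = 1%:M.
  by have /row_fullP[K KB] := fB; exists K^T; rewrite -trmx_mul KB trmx1.
have pr1 : frame dA *m VB^T = - (VA *m (frame dB)^T).
  by apply/eqP; rewrite -addr_eq0 pr.
exists (L *m frame dA); apply/given_by_frame; split; last first.
  rewrite -/VB -[VB]trmxK -trmx_mul -mulmxA pr1 mulmxN mulmxA LA mul1mx.
  by rewrite linearN /= trmxK opprK.
have -> : frame dA = - (VA *m (frame dB)^T *m N).
  by rewrite -mulNmx -pr1 -mulmxA BN mulmx1.
by rewrite !mulmxN !mulmxA -(mulmxA VA L VA) LA mulmx1.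
Qed.

Lemma generator_inj A B dA dB D D' : row_full (frame A) ->
  given_by D A B dA dB -> given_by D' A B dA dB -> D = D'.
Proof.
move=> fA /given_by_frame[e1 _] /given_by_frame[e2 _].
have /row_fullP[L LA] := fA.
by rewrite -[D]mul1mx -[D']mul1mx -LA -!mulmxA -e1 -e2.
Qed.

End Motions.

(** * Quartic rigidity implies rigidity *)

Section Rigidity.
Variables (R : realType) (p q : nat).
Implicit Types (x y : 'rV[R]_3) (K D G : 'M[R]_3) (M : 'M[R]_(p, q)).
Implicit Types (A dA : 'I_p -> 'M[R]_2) (B dB : 'I_q -> 'M[R]_2).

Local Notation J := (J3 R).
Local Notation lightlike X := (lor (vec X) (vec X) = 0).

(** No nonzero quartic separates the rays of the rank-one [A i] from the rays
    of the adjugates of the rank-one [B j]. *)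
Definition quartic_rigid A B := forall K,
  (forall i, lightlike (A i) -> 0 <= qform K (vec (A i))) ->
  (forall j, lightlike (B j) -> qform K (vec (B j) *m J) <= 0) ->
  quartic K = 0.

(** The first order terms of a motion form a quartic with the signs that
    quartic rigidity excludes, so [D] is tangent to the cone at every light ray.
    The displacement of a light vector is then orthogonal to it, hence nowhere
    timelike, while a second order motion makes it non-spacelike at the [A i];
    so the quartic of second order terms has the excluded signs as well and
    vanishes.  Both identities concern the whole light cone, so they hold for
    every other factorization. *)
Lemma quartic_rigid_inf_rigid s A B : s = 1%N \/ s = 2%N ->
  (forall i, psdmx (A i)) -> (forall j, psdmx (B j)) ->
  row_full (frame A) -> row_full (frame B) ->
  quartic_rigid A B -> inf_rigid s A B.
Proof.
move=> s12 pA pB fA fB rig dA dB mot.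
have sA i : (A i)^T = A i by case: (pA i).
have sB j : (B j)^T = B j by case: (pB j).
have [_ _ pr _] := (inf_motionP _ _ s12 sA sB).1 mot.
have [D gD] := motion_generator fA fB pr.
have [hA hB] := motion_lightlike s12 sA sB mot gD.
have DJ0 : quartic (D *m J) = 0.
  apply: rig => [i li|j lj]; first by rewrite qform_DJ; case: (hA i li).
  by rewrite qform_DJ_dual -oppr_ge0 -lorNr; exact: hB.
have perp x : cone x -> lor x x = 0 -> lor x (x *m D) = 0.
  by move=> cx lx; rewrite -qform_DJ; exact: qform_lightlike.
have perp_dual x : cone x -> lor x x = 0 -> lor x (x *m D^T) = 0.
  move=> cx lx; rewrite -qform_DJ_dual; apply: qform_lightlike => //.
    exact: cone_J3.
  by rewrite lor_J3.
have order2 : s = 2%N -> quartic (D *m J *m D^T) = 0.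
  move=> s2; apply: rig => [i li|j lj]; rewrite qform_DJD.
    case: (hA i li) => _; apply=> //; apply: perp => //; exact: psd_vec.
  have cB := psd_vec (pB j).
  have [e|nz] := eqVneq (vec (B j)) 0; first by rewrite e /lor !mul0mx mxE.
  apply: (@cone_lor_perp _ (vec (B j) *m J)).
  - exact: cone_J3.
  - by apply: contra_neq nz => e; rewrite -(J3_K (vec _)) e mul0mx.
  - by apply: perp; [exact: cone_J3 | rewrite lor_J3].
have lorD2 x : s = 2%N -> cone x -> lor x x = 0 -> lor (x *m D) (x *m D) = 0.
  move=> s2 cx lx; rewrite -qform_DJD.
  by apply: qform_lightlike => //; exact: order2.
have DJ_conf := quartic_eq0 DJ0; rewrite trmx_mul J3_sym in DJ_conf.
exists D => // M' A' B' _ [pA' pB' _].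
exists (motionA D A'), (motionB D B'); split; first exact: motion_given_by.
apply: motion_of => // [i li|j lj].
  have cA := psd_vec (pA' i).
  by rewrite perp //; split=> // _ s2; rewrite lorD2.
have cB := psd_vec (pB' j).
rewrite lorNr lorNN perp_dual // oppr0; split=> // _ s2.
by rewrite (conformal_dual _ DJ_conf) lorD2 ?lor_J3 //; exact: cone_J3.
Qed.

Lemma change_of_frame A B A' B' :
  row_full (frame A) -> row_full (frame B') ->
  frame A *m (frame B)^T = frame A' *m (frame B')^T ->
  exists G, frame A' = frame A *m G /\ frame B = frame B' *m G^T.
Proof.
move=> fA fB' e.
have /row_fullP[L LA] := fA.
have [N BN] : exists N, (frame B')^T *m N = 1%:M.
  by have /row_fullP[K KB] := fB'; exists K^T; rewrite -trmx_mul KB trmx1.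
have eA' : frame A' = frame A *m ((frame B)^T *m N).
  by rewrite mulmxA e -mulmxA BN mulmx1.
exists (L *m frame A'); split.
  by rewrite {1}eA' eA' (mulmxA L) LA mul1mx.
by rewrite -[frame B']trmxK -trmx_mul -mulmxA -e mulmxA LA mul1mx trmxK.
Qed.

(** In odd dimension, comparing determinants shows that [k ^+ 3] is a square. *)
Lemma J3_conformal_gt0 G (k : R) :
  G \in unitmx -> G *m J *m G^T = k *: J -> 0 < k.
Proof.
move=> uG /(congr1 determinant); rewrite !det_mulmx det_tr detZ => e.
have dJ : \det J != 0.
  have : \det J * \det J = 1 by rewrite -det_mulmx J3_sq det1.
  move=> h; apply: contraPneq h => ->.
  by rewrite mulr0 => /esym/eqP; rewrite oner_eq0.
have k3 : \det G ^+ 2 = k ^+ 3.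
  by apply: (mulIf dJ); rewrite -e expr2; ring.
have : 0 < k ^+ 3.
  by rewrite -k3 exprn_even_gt0 //= -unitfE -unitmxE.
by rewrite exprn_odd_gt0.
Qed.

(** If the image of [e] lay in the opposite cone, its products with the [A' i]
    would be nonpositive.  Up to the factor [k] these are the products of [e]
    with the [A i], which are nonnegative; so [e] would be orthogonal to a
    spanning family. *)
Lemma conformal_cone_row A A' G (k : R) (e : 'rV[R]_3) : 0 < k ->
  G *m J *m G^T = k *: J -> row_full (frame A) ->
  (forall i, cone (vec (A i))) -> (forall i, cone (vec (A' i))) ->
  (forall i, vec (A' i) = vec (A i) *m G) ->
  cone e -> lor e e = 0 -> e != 0 -> cone (e *m G).
Proof.
move=> k0 GJ fA cA cA' eA ce le ne.
have lorG x y : lor (x *m G) (y *m G) = k * lor x y.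
  rewrite /lor trmx_mul !mulmxA -(mulmxA x) -(mulmxA x) GJ.
  by rewrite -scalemxAr -scalemxAl mxE.
have lG : lor (e *m G) (e *m G) = 0 by rewrite lorG le mulr0.
have [//|cN] := lightlike_coneN lG.
have nJ : e *m J != 0 by apply: contra_neq ne => h; rewrite -(J3_K e) h mul0mx.
have [i] := full_row_witness fA nJ.
rewrite trmx_mul J3_sym mulmxA -[_ 0 0]/(lor _ _) => /negP[]; apply/eqP.
apply: le_anti; rewrite (cone_lor_ge0 (cA i) ce) andbT.
have := cone_lor_ge0 (cA' i) cN.
by rewrite lorNr eA lorG oppr_ge0 pmulr_rle0.
Qed.

(** Let [G] carry [A] to [A']; the form [G *m J *m G^T] is nonnegative at the
    [A i], whose images are psd.  If [x] is the light vector adjugate to [B j],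
    then [x *m G] pairs to zero with the psd factor [B' j], so it is not
    timelike.  These are the excluded signs, so [G] multiplies the Lorentz form
    by a constant and is a congruence. *)
Lemma quartic_rigid_globally_rigid M A B :
  psd_factorization M A B -> \rank M = 3%N -> (forall i j, 0 < M i j) ->
  quartic_rigid A B -> globally_rigid M A B.
Proof.
move=> HAB rM Mpos rig A' B' HAB'.
have [pA pB eM] := (factorization_frame M A B).1 HAB.
have [pA' pB' eM'] := (factorization_frame M A' B').1 HAB'.
have [fA fB] : row_full (frame A) /\ row_full (frame B).
  by apply: rank3_frames; rewrite -eM.
have [fA' fB'] : row_full (frame A') /\ row_full (frame B').
  by apply: rank3_frames; rewrite -eM'.
have [G [eA eB]] :
    exists G, frame A' = frame A *m G /\ frame B = frame B' *m G^T.
  by apply: change_of_frame; rewrite // -eM.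
have vA i : vec (A' i) = vec (A i) *m G by rewrite -!row_frame eA row_mul.
have vB j : vec (B j) = vec (B' j) *m G^T by rewrite -!row_frame eB row_mul.
have uG : G \in unitmx.
  rewrite -row_full_unit /row_full eqn_leq rank_leq_col /=.
  by rewrite -{1}(eqP fA') eA mxrankM_maxr.
have i0 : 'I_p.
  have : (0 < p)%N by apply: leq_trans (rank_leq_row M); rewrite rM.
  by case: (p) => // n _; exact: ord0.
have cA' i := psd_vec (pA' i); have cB' j := psd_vec (pB' j).
have nzB' j : vec (B' j) != 0.
  apply/eqP => e; have := Mpos i0 j.
  by rewrite eM' frame_mulE e trmx0 mulmx0 mxE ltxx.
have GJ0 : quartic (G *m J *m G^T) = 0.
  apply: rig => [i li|j lj]; rewrite qform_DJD.
    by rewrite -vA; case: (cA' i).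
  apply: (@cone_lor_perp _ (vec (B' j) *m J)).
  - exact: cone_J3.
  - by apply: contra_neq (nzB' j) => e; rewrite -(J3_K (vec _)) e mul0mx.
  have -> : lor (vec (B' j) *m J) (vec (B j) *m J *m G) =
            lor (vec (B j)) (vec (B j)).
    by rewrite {1}/lor J3_K !trmx_mul J3_sym !mulmxA -vB.
  exact: lj.
have sK : (G *m J *m G^T)^T = G *m J *m G^T.
  by rewrite !trmx_mul trmxK J3_sym mulmxA.
have [k GJ] : exists k, G *m J *m G^T = k *: J.
  have := quartic_eq0 GJ0; rewrite sK => e.
  exists (((G *m J *m G^T) 0 1 + (G *m J *m G^T) 1 0) / 2).
  apply: (scalerI (a := 2)); first by rewrite pnatr_eq0.
  by rewrite scaler_nat mulr2n e scalerA mulrC divfK // pnatr_eq0.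
have k0 := J3_conformal_gt0 uG GJ.
have coneG z : cone (veronese z *m G).
  apply: (conformal_cone_row k0 GJ fA _ cA' vA) => [i|||].
  - exact: psd_vec.
  - exact: veronese_cone.
  - exact: veronese_lightlike.
  - exact: veronese_neq0.
have e0 : row 0 G = veronese (Some 0) *m G.
  rewrite rowE; congr (_ *m G); apply: row3P; rewrite !mxE //= ?expr2 ?mulr0 //.
have e1 : row 1 G = veronese None *m G.
  by rewrite rowE; congr (_ *m G); apply: row3P; rewrite !mxE.
have [||S uS hS] := @conformal_congruence R G k k0 GJ; rewrite ?e0 ?e1 //.
have sA i : (A i)^T = A i by case: (pA i).
have sB j : (B j)^T = B j by case: (pB j).
exists S => //; split=> [i|j].
  apply: vec_inj; first by case: (pA' i).
    by rewrite !trmx_mul trmxK sA mulmxA.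
  by rewrite hS.
set Bj := invmx S *m B j *m (invmx S)^T.
have sBj : Bj^T = Bj by rewrite !trmx_mul trmxK sB mulmxA.
apply: vec_inj => //; first by case: (pB' j).
apply/eqP; rewrite -subr_eq0; apply: contraT => nz.
have [i] := full_row_witness fA' nz.
have sA' : (A' i)^T = A' i by case: (pA' i).
have sB' : (B' j)^T = B' j by case: (pB' j).
have eAB : mxdot (A' i) Bj = M i j.
  have -> : A' i = S^T *m A i *m S.
    by apply: vec_inj; rewrite ?hS // !trmx_mul trmxK sA mulmxA.
  have [_ _ ->] := HAB.
  rewrite /mxdot /Bj !mulmxA mulmxK // mxtrace_mulC !mulmxA -trmx_mul mulmxV //.
  by rewrite trmx1 mul1mx.
rewrite dotBr -!mxdotE // eAB; have [_ _ <-] := HAB'.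
by rewrite subrr eqxx.
Qed.

End Rigidity.

(** * A separating quartic gives a nontrivial infinitesimal motion *)

Section Flexibility.
Variables (R : realType) (p q : nat).
Implicit Types (x y : 'rV[R]_3) (K D G : 'M[R]_3) (M : 'M[R]_(p, q)).
Implicit Types (A dA : 'I_p -> 'M[R]_2) (B dB : 'I_q -> 'M[R]_2).

Local Notation J := (J3 R).
Local Notation lightlike X := (lor (vec X) (vec X) = 0).

(** To first order [D] moves every lightlike factor strictly into the cone, and
    it moves the light ray with parameter [c] off the light cone. *)
Definition separating A B D c :=
  [/\ forall i, lightlike (A i) -> 0 < lor (vec (A i)) (vec (A i) *m D),
      forall j, lightlike (B j) -> 0 < lor (vec (B j)) (- (vec (B j) *m D^T)) &
      lor (veronese (Some c)) (veronese (Some c) *m D) != 0].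

(** Positivity of [M] enters here: a light ray shared by some [A i] and the
    adjugate of some [B j] would make the entry [M i j] vanish.  Hence the signs
    required of the quartic are consistent and can be made strict. *)
Lemma separating_generator M A B : psd_factorization M A B ->
  \rank M = 3%N -> (forall i j, 0 < M i j) ->
  ~ quartic_rigid A B -> exists D c, separating A B D c.
Proof.
move=> HAB rM Mpos /boolp.existsNP[K /boolp.not_implyP[hA]].
move=> /boolp.not_implyP[hB /eqP K0].
have [pA pB eM] := (factorization_frame M A B).1 HAB.
have cA i := psd_vec (pA i); have cB j := cone_J3 (psd_vec (pB j)).
have MB i j : M i j = lor (vec (A i)) (vec (B j) *m J).
  by rewrite eM frame_mulE dot_lor.
have i0 : 'I_p.
  have : (0 < p)%N by apply: leq_trans (rank_leq_row M); rewrite rM.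
  by case: (p) => // n _; exact: ord0.
have j0 : 'I_q.
  have : (0 < q)%N by apply: leq_trans (rank_leq_col M); rewrite rM.
  by case: (q) => // n _; exact: ord0.
have nzA i : vec (A i) != 0.
  apply/eqP => e; have := Mpos i j0.
  by rewrite MB e /lor !mul0mx mxE ltxx.
have nzB j : vec (B j) *m J != 0.
  apply/eqP => e; have := Mpos i0 j.
  by rewrite MB e /lor trmx0 mulmx0 mxE ltxx.
pose pt (t : 'I_p + 'I_q) : 'rV[R]_3 :=
  match t with inl i => vec (A i) | inr j => vec (B j) *m J end.
pose sg (t : 'I_p + 'I_q) : R := if t is inl _ then 1 else -1.
have ptP t : lor (pt t) (pt t) == 0 ->
    exists2 a, 0 < a & pt t = a *: veronese (ray (pt t)).
  move/eqP; case: t => [i|j] l.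
    exact: lightlike_ray (cA i) l (nzA i).
  exact: lightlike_ray (cB j) l (nzB j).
have disj i j : lor (pt (inl i)) (pt (inl i)) == 0 ->
    lor (pt (inr j)) (pt (inr j)) == 0 -> ray (pt (inl i)) != ray (pt (inr j)).
  move=> /ptP[a a0 ea] /ptP[b b0 eb]; apply: contraTneq (Mpos i j) => e.
  rewrite MB -[vec (A i)]/(pt (inl i)) -[vec (B j) *m J]/(pt (inr j)) ea eb e.
  set v := veronese _; have := veronese_lightlike (ray (pt (inr j))).
  rewrite -/v !lorE !mxE => h.
  have -> : a * v 0 0 * (b * v 0 1) + a * v 0 1 * (b * v 0 0)
      - a * v 0 2 * (b * v 0 2)
    = a * b * (v 0 0 * v 0 1 + v 0 1 * v 0 0 - v 0 2 * v 0 2) by ring.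
  by rewrite h mulr0 ltxx.
have [|||g [sg5 g0 gpos]] := @strict_signs R ('I_p + 'I_q)%type
    (fun t => lor (pt t) (pt t) == 0) (fun t => ray (pt t)) sg (quartic K)
    (size_quartic K) K0.
- by move=> [i|j] _; rewrite /= ?oppr_eq0 oner_eq0.
- move=> [i|j] [i'|j'] //= li lj e.
    by have := disj _ _ li lj; rewrite e eqxx.
  by have := disj _ _ lj li; rewrite e eqxx.
- move=> t lt; have [a a0 ea] := ptP t lt.
  have qE : qform K (pt t) = a ^+ 2 * qval (quartic K) (ray (pt t)).
    by rewrite {1}ea /qform quartic_scaled.
  have : 0 <= sg t * qform K (pt t).
    case: t lt {ea qE} => [i|j] /eqP lt /=; first by rewrite mul1r; exact: hA.
    by rewrite mulN1r oppr_ge0; apply: hB; rewrite -lor_J3.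
  by rewrite qE mulrCA pmulr_rge0 // exprn_gt0.
have [K' eK] := quartic_onto sg5.
have [c nc] := quartic_neq0P g0.
have posK t : lor (pt t) (pt t) = 0 -> 0 < sg t * qform K' (pt t).
  move=> /eqP lt; have [a a0 ea] := ptP t lt.
  have -> : qform K' (pt t) = a ^+ 2 * qval g (ray (pt t)).
    by rewrite {1}ea /qform quartic_scaled eK.
  by rewrite mulrCA mulr_gt0 ?exprn_gt0 //; exact: gpos.
have DJ : K' *m J *m J = K' by rewrite -mulmxA J3_sq mulmx1.
exists (K' *m J), c; split=> [i li|j lj|].
- by rewrite -qform_DJ DJ -[qform _ _]mul1r; exact: (posK (inl i)).
- rewrite lorNr -qform_DJ_dual DJ -mulN1r; apply: (posK (inr j)).
  by rewrite /= lor_J3.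
- by rewrite -qform_DJ DJ /qform -quarticE eK.
Qed.

(** A quadratic polynomial is determined by its values at three points. *)
Lemma veronese_span c (v : 'rV[R]_3) :
  (forall k : nat, (k < 3)%N ->
     (v *m (veronese (Some (c + k%:R)))^T) 0 0 = 0) ->
  v = 0.
Proof.
move=> h; have := h 0%N isT; have := h 1%N isT; have := h 2%N isT.
rewrite !dotE !row3E /= => h2 h1 h0.
have v1 : v 0 1 = 0 by lra.
have v2 : v 0 2 * Num.sqrt 2 = 0 by rewrite v1 in h0 h1; lra.
have {}v2 : v 0 2 = 0.
  by move/eqP: v2; rewrite mulf_eq0 (negPf (sqrt2_neq0 R)) orbF => /eqP.
by apply: row3P; rewrite [RHS]mxE //; rewrite v1 v2 in h0; lra.
Qed.

(** Triviality of the motion is refuted by a factorization whose first factor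
    on both sides sits on the light ray with parameter [c]: the two first order
    conditions there are opposite, so the form of [D] would vanish at that ray.
    The other factors are placed on other light rays, which makes them span. *)
Lemma separating_not_inf_rigid s A B D c : s = 1%N \/ s = 2%N ->
  (2 < p)%N -> (2 < q)%N ->
  (forall i, psdmx (A i)) -> (forall j, psdmx (B j)) -> row_full (frame A) ->
  separating A B D c -> ~ inf_rigid s A B.
Proof.
move=> s12 p3 q3 pA pB fA [sepA sepB sepc] rig.
have mot : inf_motion s A B (motionA D A) (motionB D B).
  apply: motion_of => // [i /sepA h|j /sepB h]; split=> [|e];
    by [exact: ltW | rewrite e ltxx in h].
have [D' gD' triv] := rig _ _ mot.
have eD : D' = D := generator_inj fA gD' (motion_given_by D A B).
rewrite {}eD {gD' D'} in triv.
pose ver m (i : 'I_m) := veronese (Some (c + (i : nat)%:R)).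
pose A' (i : 'I_p) := unvec (ver p i).
pose B' (j : 'I_q) := unvec (ver q j *m J).
have pA' i : psdmx (A' i).
  by apply/psd_cone; rewrite unvec_sym unvecK; split=> //; exact: veronese_cone.
have pB' j : psdmx (B' j).
  apply/psd_cone; rewrite unvec_sym unvecK; split=> //.
  by apply: cone_J3; exact: veronese_cone.
have frame_dot m (F : 'I_m -> 'M[R]_2) (v : 'rV[R]_3) i :
    (frame F *m v^T) i 0 = (v *m (vec (F i))^T) 0 0.
  have -> : (frame F *m v^T) i 0 = (vec (F i) *m v^T) 0 0.
    by rewrite -row_frame -row_mul [RHS]mxE.
  by rewrite !dotE ![v 0 _ * _]mulrC.
have fA' : row_full (frame A').
  apply: row_full_kernel => v /matrixP e; apply: (@veronese_span c) => k k3.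
  have := e (Ordinal (leq_trans k3 p3)) 0.
  by rewrite frame_dot /A' unvecK [RHS]mxE.
have fB' : row_full (frame B').
  apply: row_full_kernel => v /matrixP e; rewrite -[v]J3_K.
  suff -> : v *m J = 0 by rewrite mul0mx.
  apply: (@veronese_span c) => k k3.
  have := e (Ordinal (leq_trans k3 q3)) 0.
  by rewrite frame_dot /B' unvecK trmx_mul J3_sym mulmxA [RHS]mxE.
have HAB' : psd_factorization (frame A' *m (frame B')^T) A' B'.
  exact/factorization_frame.
have rk := factorization_rank3_psd_rank2 HAB' fA' fB'.
have [dA' [dB' [gD' mot']]] := triv _ _ _ rk HAB'.
have sA' i : (A' i)^T = A' i by case: (pA' i).
have sB' j : (B' j)^T = B' j by case: (pB' j).
have [hA hB] := motion_lightlike s12 sA' sB' mot' gD'.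
have p0 : (0 < p)%N by exact: leq_trans p3.
have q0 : (0 < q)%N by exact: leq_trans q3.
have := hA (Ordinal p0); have := hB (Ordinal q0).
rewrite !unvecK lor_J3 !veronese_lightlike lorNr -qform_DJ_dual J3_K qform_DJ.
rewrite /ver /= addr0 => /(_ erefl) le0 /(_ erefl) [ge0 _].
by case/eqP: sepc; apply: le_anti; rewrite ge0 -oppr_ge0 le0.
Qed.

End Flexibility.

(** * Integrating a separating generator *)

Section Local.
Variable R : realType.
Implicit Types (x y : 'rV[R]_3) (D : 'M[R]_3).

Lemma id_right : t @[t --> (0 : R)^'+] --> (0 : R).
Proof. exact/cvg_at_right_filter/cvg_id. Qed.

Lemma cvg_dot (r : R -> 'rV[R]_3) x y :
  (forall k, r t 0 k @[t --> 0^'+] --> x 0 k) ->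
  (r t *m y^T) 0 0 @[t --> 0^'+] --> (x *m y^T) 0 0.
Proof.
move=> rx; rewrite dotE; under eq_fun do rewrite dotE.
by apply: cvgD; [apply: cvgD|]; apply: cvgM => //; exact: cvg_cst.
Qed.

Lemma cvg_lor (r w : R -> 'rV[R]_3) x y :
  (forall k, r t 0 k @[t --> 0^'+] --> x 0 k) ->
  (forall k, w t 0 k @[t --> 0^'+] --> y 0 k) ->
  lor (r t) (w t) @[t --> 0^'+] --> lor x y.
Proof.
move=> rx wy; rewrite lorE; under eq_fun do rewrite lorE.
by apply: cvgB; [apply: cvgD|]; apply: cvgM.
Qed.

(** On the light cone the norm of [x + t *: r t] is [t] times a quantity that
    converges to twice [lor x y]; the trace excludes the opposite cone. *)
Lemma near_cone x (r : R -> 'rV[R]_3) y : cone x -> x != 0 ->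
  (forall k, r t 0 k @[t --> 0^'+] --> y 0 k) ->
  (lor x x = 0 -> 0 < lor x y) ->
  \forall t \near 0^'+, cone (x + t *: r t).
Proof.
move=> [x0 x1 xx] nz ry xy.
have cx k : x 0 k @[t --> (0 : R)^'+] --> x 0 k by exact: cvg_cst.
have xr k : (x + t *: r t) 0 k @[t --> 0^'+] --> x 0 k.
  suff : (x + t *: r t) 0 k @[t --> 0^'+] --> x 0 k + 0 * y 0 k.
    by rewrite mul0r addr0.
  under eq_fun do rewrite !mxE.
  by apply: cvgD; [exact: cvg_cst | apply: cvgM; [exact: id_right | exact: ry]].
have tr0 : 0 < x 0 0 + x 0 1.
  rewrite lt_neqAle addr_ge0 // andbT eq_sym; apply: contra_neq nz => e.
  have e0 : x 0 0 = 0 by lra.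
  have e1 : x 0 1 = 0 by lra.
  by apply: row3P; rewrite mxE //; rewrite lorE e0 e1 in xx; nra.
have near_tr := near_gt0 (cvgD (xr 0) (xr 1)) tr0.
suff near_det : \forall t \near 0^'+, 0 <= lor (x + t *: r t) (x + t *: r t).
  near=> t; apply: cone_trace; near: t; [exact: near_tr | exact: near_det].
have [lx|nx] := eqVneq (lor x x) 0; last first.
  have lt0 : 0 < lor x x by rewrite lt_neqAle eq_sym nx.
  by apply: filterS (near_gt0 (cvg_lor xr xr) lt0) => t /ltW.
have cv : lor x (r t) + t / 2 * lor (r t) (r t) @[t --> 0^'+] --> lor x y.
  suff : lor x (r t) + t / 2 * lor (r t) (r t) @[t --> 0^'+] -->
      lor x y + 0 / 2 * lor y y by rewrite !mul0r addr0.
  apply: cvgD; first exact: cvg_lor.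
  apply: cvgM; last exact: cvg_lor.
  by apply: cvgM; [exact: id_right | exact: cvg_cst].
have near_p := near_gt0 cv (xy lx).
near=> t.
have -> : lor (x + t *: r t) (x + t *: r t) =
    lor x x + t * (2 * (lor x (r t) + t / 2 * lor (r t) (r t))).
  by rewrite !lorE !mxE; field.
rewrite lx add0r mulr_ge0 // mulr_ge0 //; apply: ltW; near: t; exact: near_p.
Unshelve. all: by end_near.
Qed.

Definition flow D t : 'M[R]_3 := 1%:M + t *: D.

Definition flow_inv D t : 'M[R]_3 := (\det (flow D t))^-1 *: \adj (flow D t).

(** The flow with an indeterminate time, which makes the entries of its adjugate
    polynomials, hence continuous. *)
Let flow_poly D : 'M[{poly R}]_3 := 1%:M + 'X *: map_mx polyC D.

Lemma flow_polyE D t : flow D t = map_mx (horner_eval t) (flow_poly D).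
Proof.
apply/matrixP => i j; rewrite !mxE /horner_eval hornerD hornerM hornerX hornerC.
by rewrite -[in RHS]polyC_natr hornerC.
Qed.

Lemma flow0 D : flow D 0 = 1%:M.
Proof. by rewrite /flow scale0r addr0. Qed.

Lemma det_flow_cvg D : \det (flow D t) @[t --> 0^'+] --> (1 : R).
Proof.
have e t : \det (flow D t) = (\det (flow_poly D)).[t].
  by rewrite flow_polyE det_map_mx.
suff : \det (flow D t) @[t --> 0^'+] --> \det (flow D 0) by rewrite flow0 det1.
by rewrite e; under eq_fun do rewrite e; exact: horner_right.
Qed.

Lemma adj1 n : \adj (1%:M : 'M[R]_n) = 1%:M.
Proof. by rewrite -[LHS]mul1mx mul_mx_adj det1. Qed.

Lemma flow_inv_cvg D i j :
  flow_inv D t i j @[t --> 0^'+] --> (1%:M : 'M[R]_3) i j.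
Proof.
have e t : (\adj (flow D t)) i j = (\adj (flow_poly D) i j).[t].
  by rewrite flow_polyE -map_mx_adj mxE.
suff : flow_inv D t i j @[t --> 0^'+] --> 1^-1 * (1%:M : 'M[R]_3) i j.
  by rewrite invr1 mul1r.
under eq_fun do rewrite /flow_inv mxE e.
apply: cvgM; first by apply: cvgV; [exact: oner_neq0 | exact: det_flow_cvg].
by rewrite -[1%:M in X in _ --> X]adj1 -(flow0 D) e; exact: horner_right.
Qed.

Lemma mul_flow_inv D t :
  \det (flow D t) != 0 -> flow D t *m flow_inv D t = 1%:M.
Proof.
by move=> d0; rewrite /flow_inv -scalemxAr mul_mx_adj scale_scalar_mx mulVf.
Qed.

Lemma near_flow_unit D : \forall t \near 0^'+, \det (flow D t) != 0.
Proof. by apply: filterS (near_gt0 (det_flow_cvg D) ltr01) => t /lt0r_neq0. Qed.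

(** Unlike [x *m flow D t], the inverse path is not affine in the time
    parameter; it is affine up to a factor that converges. *)
Lemma flow_inv_affine D x t : \det (flow D t) != 0 ->
  x *m (flow_inv D t)^T = x + t *: (- (x *m (flow_inv D t)^T *m D^T)).
Proof.
move=> d0; have : x *m (flow_inv D t)^T *m (flow D t)^T = x.
  by rewrite -mulmxA -trmx_mul mul_flow_inv // trmx1 mulmx1.
move: (x *m _) => w; rewrite /flow linearD /= trmx1 mulmxDr mulmx1 linearZ /=.
by rewrite -scalemxAr => <-; rewrite scalerN addrK.
Qed.

Lemma flow_inv_row_cvg D x k :
  (x *m (flow_inv D t)^T) 0 k @[t --> 0^'+] --> x 0 k.
Proof.
have e t : (x *m (flow_inv D t)^T) 0 k = (row k (flow_inv D t) *m x^T) 0 0.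
  by rewrite !mxE; apply: eq_bigr => l _; rewrite !mxE mulrC.
under eq_fun do rewrite e.
have -> : x 0 k = (row k 1%:M *m x^T) 0 0 by rewrite -row_mul mul1mx !mxE.
apply: cvg_dot => l; rewrite mxE; under eq_fun do rewrite mxE.
exact: flow_inv_cvg.
Qed.

Lemma near_cone_flow D x : cone x -> x != 0 ->
  (lor x x = 0 -> 0 < lor x (x *m D)) ->
  \forall t \near 0^'+, cone (x *m flow D t).
Proof.
move=> cx nz h.
have cv k : (x *m D) 0 k @[_ --> (0 : R)^'+] --> (x *m D) 0 k by exact: cvg_cst.
apply: filterS (near_cone cx nz cv h) => t.
by rewrite /flow mulmxDr mulmx1 -scalemxAr.
Qed.

Lemma near_cone_flow_inv D x : cone x -> x != 0 ->
  (lor x x = 0 -> 0 < lor x (- (x *m D^T))) ->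
  \forall t \near 0^'+, cone (x *m (flow_inv D t)^T).
Proof.
move=> cx nz h.
have cv k : (- (x *m (flow_inv D t)^T *m D^T)) 0 k @[t --> 0^'+]
    --> (- (x *m D^T)) 0 k.
  have e y : (- (y *m D^T)) 0 k = - (y *m (row k D)^T) 0 0.
    by rewrite !mxE; congr (- _); apply: eq_bigr => l _; rewrite !mxE.
  rewrite e; under eq_fun do rewrite e.
  by apply: cvgN; apply: cvg_dot => l; exact: flow_inv_row_cvg.
have near1 := near_cone cx nz cv h; have near2 := near_flow_unit D.
near=> t; rewrite flow_inv_affine; first by near: t; exact: near1.
by near: t; exact: near2.
Unshelve. all: by end_near.
Qed.

End Local.

(** * Convergence of tuples of matrices *)

Section Convergence.
Variable R : realType.

Lemma cvg_mx_entries (T : Type) (F : set_system T) (FF : Filter F) m n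
    (f : T -> 'M[R]_(m, n)) (X : 'M[R]_(m, n)) :
  (forall i j, f t i j @[t --> F] --> X i j) -> f t @[t --> F] --> X.
Proof.
move=> fX U [P XP PU]; rewrite /nbhs /=.
have : \forall t \near F, forall i j, P i j (f t i j).
  apply: filter_forall => i; apply: filter_forall => j.
  exact: fX (XP i j).
by apply: filterS => t Pt; apply: PU.
Qed.

Lemma cvg_prod_topology (T : Type) (F : set_system T) (FF : Filter F)
    (I : Type) (Y : topologicalType) (f : T -> prod_topology (fun _ : I => Y))
    (g : prod_topology (fun _ : I => Y)) :
  (forall i, f t i @[t --> F] --> g i) -> f t @[t --> F] --> g.
Proof.
move=> fg; apply/cvg_sup => i U.
rewrite nbhsE => -[V [[W oW eV] Vg] VU].
have near_W : \forall t \near F, W (f t i).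
  by apply: (fg i); apply: open_nbhs_nbhs; split=> //; rewrite -eV in Vg.
by apply: filterS near_W => t Wt; apply: VU; rewrite -eV.
Qed.

Lemma cvg_mx2_tuples (T : Type) (F : set_system T) (FF : Filter F) p q
    (f : T -> 'I_p -> 'M[R]_2) (g : T -> 'I_q -> 'M[R]_2)
    (A : 'I_p -> 'M[R]_2) (B : 'I_q -> 'M[R]_2) :
  (forall i a b, f t i a b @[t --> F] --> A i a b) ->
  (forall j a b, g t j a b @[t --> F] --> B j a b) ->
  ((f t, g t) : mx2_tuples R p q) @[t --> F] --> ((A, B) : mx2_tuples R p q).
Proof.
move=> fA gB.
have cA : (f t : prod_topology (fun _ : 'I_p => 'M[R]_2)) @[t --> F] -->
    (A : prod_topology (fun _ : 'I_p => 'M[R]_2)).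
  by apply: cvg_prod_topology => i; apply: cvg_mx_entries.
have cB : (g t : prod_topology (fun _ : 'I_q => 'M[R]_2)) @[t --> F] -->
    (B : prod_topology (fun _ : 'I_q => 'M[R]_2)).
  by apply: cvg_prod_topology => j; apply: cvg_mx_entries.
exact: cvg_pair cA cB.
Qed.

Lemma cvg_unvec (r : R -> 'rV[R]_3) (X : 'M[R]_2) a b : X^T = X ->
  (forall k, r t 0 k @[t --> (0 : R)^'+] --> vec X 0 k) ->
  unvec (r t) a b @[t --> (0 : R)^'+] --> X a b.
Proof.
move=> sX rX; have -> : X a b = unvec (vec X) a b by rewrite vecK.
have offdiag k : r t 0 k / Num.sqrt 2 @[t --> (0 : R)^'+] -->
    vec X 0 k / Num.sqrt 2.
  by apply: cvgM; [exact: rX | exact: cvg_cst].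
by elim/ord2P: a; elim/ord2P: b; rewrite unvecE; under eq_fun do rewrite unvecE;
  first [exact: rX | exact: offdiag].
Qed.

End Convergence.

(** * Separating generators contradict local rigidity *)

Section LocalRigidity.
Variables (R : realType) (p q : nat) (M : 'M[R]_(p, q)).
Variables (A : 'I_p -> 'M[R]_2) (B : 'I_q -> 'M[R]_2).

(** The flow of [D] and its inverse act on the two sides, so the product of
    frames is unchanged, and the factors stay psd for small positive times.  If
    the moved factorization were in the orbit, the flow would be a congruence,
    as the [A i] span; but it moves the light ray with parameter [c] off the
    light cone. *)
Lemma separating_not_locally_rigid D c : psd_factorization M A B ->
  row_full (frame A) ->
  (forall i, vec (A i) != 0) -> (forall j, vec (B j) != 0) ->
  separating A B D c -> ~ locally_rigid M A B.
Proof.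
move=> HAB fA nzA nzB [sepA sepB sepc] loc.
have [pA pB eM] := (factorization_frame M A B).1 HAB.
have sA i : (A i)^T = A i by case: (pA i).
have sB j : (B j)^T = B j by case: (pB j).
pose At t i := unvec (vec (A i) *m flow D t).
pose Bt t j := unvec (vec (B j) *m (flow_inv D t)^T).
have cvAB : ((At t, Bt t) : mx2_tuples R p q) @[t --> (0 : R)^'+] -->
    ((A, B) : mx2_tuples R p q).
  apply: cvg_mx2_tuples => [i|j] a b; apply: cvg_unvec => // k.
    have e t : (vec (A i) *m flow D t) 0 k =
               vec (A i) 0 k + t * (vec (A i) *m D) 0 k.
      by rewrite /flow mulmxDr mulmx1 -scalemxAr !mxE.
    under eq_fun do rewrite e.
    suff : vec (A i) 0 k + t * (vec (A i) *m D) 0 k @[t --> (0 : R)^'+] -->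
      vec (A i) 0 k + 0 * (vec (A i) *m D) 0 k by rewrite mul0r addr0.
    apply: cvgD; first exact: cvg_cst.
    by apply: cvgM; [exact: id_right | exact: cvg_cst].
  exact: flow_inv_row_cvg.
have near_orbit : \forall t \near 0^'+,
    psd_factorization M (At t) (Bt t) -> GL2_orbit A B (At t) (Bt t).
  exact: cvAB loc.
have near_A : \forall t \near 0^'+, forall i, cone (vec (A i) *m flow D t).
  apply: filter_forall => i; apply: near_cone_flow => //; first exact: psd_vec.
  exact: sepA.
have near_B : \forall t \near 0^'+,
    forall j, cone (vec (B j) *m (flow_inv D t)^T).
  apply: filter_forall => j; apply: near_cone_flow_inv => //.
    exact: psd_vec.
  exact: sepB.
have near_det := near_flow_unit D.
pose v := veronese (Some c).
have near_v : \forall t \near 0^'+, lor (v *m flow D t) (v *m flow D t) != 0.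
  pose a := 2 * lor v (v *m D).
  have a2 : 0 < a ^+ 2.
    by rewrite exprn_even_gt0 //= mulf_neq0 // pnatr_eq0.
  have := near_affine_gt0 (a * lor (v *m D) (v *m D)) a2.
  move=> near_a; near=> t.
  have -> : lor (v *m flow D t) (v *m flow D t) =
      lor v v + t * (a + t * lor (v *m D) (v *m D)).
    by rewrite /a /flow mulmxDr mulmx1 -scalemxAr !lorE !mxE; ring.
  rewrite veronese_lightlike add0r mulf_neq0 //.
  have : 0 < a ^+ 2 + t * (a * lor (v *m D) (v *m D)) by near: t.
  have -> : a ^+ 2 + t * (a * lor (v *m D) (v *m D)) =
    a * (a + t * lor (v *m D) (v *m D)) by ring.
  by apply: contraTneq => ->; rewrite mulr0 ltxx.
have near_all : \forall t \near 0^'+, [/\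
    psd_factorization M (At t) (Bt t) -> GL2_orbit A B (At t) (Bt t),
    forall i, cone (vec (A i) *m flow D t),
    forall j, cone (vec (B j) *m (flow_inv D t)^T),
    \det (flow D t) != 0 & lor (v *m flow D t) (v *m flow D t) != 0].
  by near=> t; split; near: t.
have [t [orb cAt cBt dt nv]] := filter_ex near_all.
have [|S uS [eAt _]] := orb.
  apply/factorization_frame; split=> [i|j|].
  - by apply/psd_cone; rewrite unvec_sym unvecK.
  - by apply/psd_cone; rewrite unvec_sym unvecK.
  have -> : frame (At t) = frame A *m flow D t.
    by apply/row_matrixP => i; rewrite row_mul !row_frame unvecK.
  have -> : frame (Bt t) = frame B *m (flow_inv D t)^T.
    by apply/row_matrixP => j; rewrite row_mul !row_frame unvecK.
  by rewrite trmx_mul trmxK mulmxA -(mulmxA (frame A)) mul_flow_inv // mulmx1.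
have eflow : flow D t = congruence_mx S.
  have /row_fullP[L LA] := fA.
  rewrite -[LHS]mul1mx -[RHS]mul1mx -LA -!mulmxA; congr (_ *m _).
  apply/row_matrixP => i; rewrite !row_mul !row_frame mul_congruence_mx vecK //.
  by rewrite -eAt unvecK.
by move: nv; rewrite eflow lor_congruence_mx veronese_lightlike mulr0 eqxx.
Unshelve. all: by end_near.
Qed.

End LocalRigidity.

Lemma globally_locally_rigid (R : realType) (p q : nat) (M : 'M[R]_(p, q))
    A B : globally_rigid M A B -> locally_rigid M A B.
Proof.
move=> glob; rewrite /locally_rigid.
apply: (@filterS _ (nbhs ((A, B) : mx2_tuples R p q)) _ setT).
  2: exact: filterT.
by move=> [A' B'] _ /=; exact: glob.
Qed.

Theorem theorem8 (R : realType) (p q : nat) (M : 'M[R]_(p, q))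
    (A : 'I_p -> 'M[R]_2) (B : 'I_q -> 'M[R]_2)
    (HM : rank3_psd_rank2 M) (Mpos : forall i j, 0 < M i j)
    (HAB : psd_factorization M A B) :
  [<-> inf_rigid 1 A B;
       inf_rigid 2 A B;
       locally_rigid M A B;
       globally_rigid M A B].
Proof.
have [_ rM _] := HM.
have [pA pB eM] := (factorization_frame M A B).1 HAB.
have [fA fB] : row_full (frame A) /\ row_full (frame B).
  by apply: rank3_frames; rewrite -eM.
have p3 : (2 < p)%N by have := rank_leq_row M; rewrite rM.
have q3 : (2 < q)%N by have := rank_leq_col M; rewrite rM.
have nzA i : vec (A i) != 0.
  apply/eqP => e; have := Mpos i (Ordinal (leq_trans (isT : (0 < 3)%N) q3)).
  by rewrite eM frame_mulE e mul0mx mxE ltxx.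
have nzB j : vec (B j) != 0.
  apply/eqP => e; have := Mpos (Ordinal (leq_trans (isT : (0 < 3)%N) p3)) j.
  by rewrite eM frame_mulE e trmx0 mulmx0 mxE ltxx.
have rigid_inf s : s = 1%N \/ s = 2%N -> inf_rigid s A B <-> quartic_rigid A B.
  move=> s12; split=> [rig|]; last exact: quartic_rigid_inf_rigid.
  apply: boolp.contrapT => /(separating_generator HAB rM Mpos)[D [c sep]].
  exact: (separating_not_inf_rigid s12 p3 q3 pA pB fA sep).
have rigid1 := rigid_inf 1%N (or_introl erefl).
have rigid2 := rigid_inf 2%N (or_intror erefl).
tfae.
- by move=> /rigid1/rigid2.
- move=> /rigid2 rig; apply: globally_locally_rigid.
  exact: quartic_rigid_globally_rigid rig.
- move=> loc; apply: quartic_rigid_globally_rigid => //.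
  apply: boolp.contrapT => /(separating_generator HAB rM Mpos)[D [c sep]].
  exact: separating_not_locally_rigid sep loc.
- move=> glob; apply/rigid1.
  apply: boolp.contrapT => /(separating_generator HAB rM Mpos)[D [c sep]].
  exact: separating_not_locally_rigid sep (globally_locally_rigid glob).
Qed.
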